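(* Let $\mathscr{M}=\{m_n\}_{n\in\mathbb{N}_0}$ be a weight sequence and $N\ge 1$. For every $\varphi\in\mathcal{E}_{\mathscr{M}}(\mathbb{T}^N)$, $$\varphi(x)=\sum_{\xi\in\mathbb{Z}^N}\widehat{\varphi}(\xi)\,e^{ix\xi},\qquad \forall x\in\mathbb{T}^N,$$ with convergence in $\mathcal{E}_{\mathscr{M}}(\mathbb{T}^N)$. Moreover, there exist constants $C,\delta>0$ such that $$|\widehat{\varphi}(\xi)|\le C\cdot\inf_{n\in\mathbb{N}_0}\left(\frac{m_n\cdot n!}{\delta^n(1+|\xi|)^n}\right),\qquad\forall \xi\in\mathbb{Z}^N.$$
   Context: $\mathbb{N}=\{1,2,\dots\}$, $\mathbb{N}_0=\mathbb{N}\cup\{0\}$, $\mathbb{T}^N=\mathbb{R}^N/2\pi\mathbb{Z}^N$, and $|\xi|$ is the Euclidean norm of $\xi\in\mathbb{Z}^N$. A weight sequence is a sequence $\mathscr{M}=\{m_n\}_{n\in\mathbb{N}_0}$ of positive reals with: $m_0=m_1=1$; $m_n^2\le m_{n-1}m_{n+1}$ for all $n\in\mathbb{N}$; and there is $H>1$ with $m_{j+k}\le H^{j+k}m_jm_k$ for all $j,k\in\mathbb{N}_0$. $\mathcal{E}_{\mathscr{M}}(\mathbb{T}^N)$ is the space of $f\in C^\infty(\mathbb{T}^N)$ (complex-valued) for which there are $C,h>0$ with $|D^\alpha f(x)|\le C h^{|\alpha|}m_{|\alpha|}|\alpha|!$ for all $x\in\mathbb{T}^N$, $\alpha\in\mathbb{N}_0^N$,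 where $D=-i\partial$. For $h>0$, $\mathcal{E}_{\mathscr{M},h}(\mathbb{T}^N)$ is the Banach space of those $f$ with $\|f\|_{\mathscr{M},h}:=\sup_{x,\alpha}\frac{|D^\alpha f(x)|}{h^{|\alpha|}m_{|\alpha|}|\alpha|!}<\infty$. $\mathcal{E}_{\mathscr{M}}(\mathbb{T}^N)$ carries the locally convex inductive limit topology of the spaces $\mathcal{E}_{\mathscr{M},h_n}(\mathbb{T}^N)$ for any strictly increasing positive sequence $h_n\to+\infty$ (the topology does not depend on the choice). Fourier coefficients: $\widehat\varphi(\xi)=\frac{1}{(2\pi)^N}\int_{\mathbb{T}^N}e^{-ix\xi}\varphi(x)\,dx$, where $x\xi=\sum_j x_j\xi_j$. Convergence of a series over $\mathbb{Z}^N$ means convergence of the partial sums over $|\xi|\le k$ as $k\to\infty$. *)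

(* Defs.v *)
From HB Require Import structures.
From mathcomp Require Import all_boot all_order all_algebra.
From mathcomp Require Import complex.
From mathcomp Require Import all_classical all_reals all_analysis.

Set Implicit Arguments.
Unset Strict Implicit.
Unset Printing Implicit Defensive.

Import Order.TTheory GRing.Theory Num.Theory.
Import numFieldNormedType.Exports.

Local Open Scope classical_set_scope.
Local Open Scope ring_scope.
Local Open Scope complex_scope.

Definition weight_sequence (R : realType) (m : nat -> R) : Prop :=
  [/\ forall n, 0 < m n,
      m 0%N = 1 /\ m 1%N = 1,
      forall n, (0 < n)%N -> m n ^+ 2 <= m n.-1 * m n.+1
    & exists2 H : R, 1 < H &
        forall j k, m (j + k)%N <= H ^+ (j + k) * m j * m k].

Section Torus.
Context {R : realType} {N : nat}.
Implicit Types (f g : 'rV[R]_N -> R[i]) (x : 'rV[R]_N) (xi : 'rV[int]_N)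
  (alpha : 'rV[nat]_N) (m : nat -> R).

(* Functions on the torus are the 2 pi Z^N-periodic functions on R^N. *)
Definition torus_periodic f : Prop :=
  forall x xi, f (x + (2 * pi) *: map_mx intr xi) = f x.

Definition reF f : 'rV[R]_N -> R := fun x => complex.Re (f x).
Definition imF f : 'rV[R]_N -> R := fun x => complex.Im (f x).

(* R[i] is a normed space over itself but not over R in the library, so real
   differentiation of complex-valued functions is done componentwise. *)
Definition partial (j : 'I_N) f : 'rV[R]_N -> R[i] :=
  fun x => 'D_(delta_mx 0 j) (reF f) x +i* 'D_(delta_mx 0 j) (imF f) x.

(* All iterated partial derivatives, in any order, exist and are continuous. *)
Definition smooth f : Prop :=
  forall s : seq 'I_N, let g := foldr partial f s in
    [/\ continuous (reF g), continuous (imF g)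
      & forall x j, derivable (reF g) x (delta_mx 0 j) /\
                    derivable (imF g) x (delta_mx 0 j)].

Definition Cinfty_torus f : Prop := torus_periodic f /\ smooth f.

Definition mlength alpha : nat := (\sum_(j < N) alpha ord0 j)%N.

(* D^alpha, where D_j = - i * partial_j *)
Definition Dop (j : 'I_N) f : 'rV[R]_N -> R[i] := fun x => - (0 +i* 1) * partial j f x.
Definition Dmulti alpha f : 'rV[R]_N -> R[i] :=
  foldr (fun j g => iter (alpha ord0 j) (Dop j) g) f (enum 'I_N).

Definition E_M m f : Prop :=
  Cinfty_torus f /\
  exists C h : R, [/\ 0 < C, 0 < h & forall x alpha,
    Normc.normc (Dmulti alpha f x)
      <= C * h ^+ mlength alpha * m (mlength alpha) * (mlength alpha)`!%:R].

Definition norm_Mh m (h : R) f : \bar R :=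
  ereal_sup [set e : \bar R | exists x alpha,
    e = (Normc.normc (Dmulti alpha f x)
         / (h ^+ mlength alpha * m (mlength alpha) * (mlength alpha)`!%:R))%:E].

Definition E_Mh m (h : R) f : Prop :=
  Cinfty_torus f /\ (norm_Mh m h f < +oo)%E.

Definition absolutely_convex (U : set ('rV[R]_N -> R[i])) : Prop :=
  forall f g (a b : R[i]), U f -> U g -> Normc.normc a + Normc.normc b <= 1 ->
    U (fun x => a * f x + b * g x).

(* The locally convex inductive limit topology on E_M m of the normed spaces
   E_Mh m (h n), i.e. the finest locally convex topology making the inclusions
   continuous: a base of 0-neighbourhoods is given by the absolutely convex
   subsets U of E_M m whose trace on each E_Mh m (h n) is a 0-neighbourhood. *)
Definition indlim_nbhs0_base m (h : nat -> R)
    (U : set ('rV[R]_N -> R[i])) : Prop :=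
  [/\ U `<=` E_M m, absolutely_convex U
    & forall n, exists2 r : R, 0 < r &
        forall g, E_Mh m (h n) g -> (norm_Mh m (h n) g < r%:E)%E -> U g].

Definition indlim_open m (h : nat -> R)
    (G : set ('rV[R]_N -> R[i])) : Prop :=
  G `<=` E_M m /\
  forall f, G f -> exists2 U, indlim_nbhs0_base m h U &
    forall g, U g -> G (fun x => f x + g x).

Definition indlim_cvg m (h : nat -> R)
    (u : nat -> 'rV[R]_N -> R[i]) f : Prop :=
  [/\ forall k, E_M m (u k), E_M m f
    & forall G, indlim_open m h G -> G f -> \forall k \near \oo, G (u k)].

Definition expix xi x : R[i] :=
  let t : R := \sum_(j < N) x 0 j * (xi 0 j)%:~R in cos t +i* sin t.

Definition set_coord x (j : 'I_N) (t : R) : 'rV[R]_N :=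
  \row_k (if k == j then t else x 0 k).

(* The integral over the N-cube [0, 2 pi]^N, as an iterated Lebesgue integral
   in each coordinate; no coordinate of the base point 0 survives. *)
Definition torus_Rint (g : 'rV[R]_N -> R) : R :=
  foldr (fun (j : 'I_N) (G : 'rV[R]_N -> R) (x : 'rV[R]_N) =>
           \int[lebesgue_measure]_(t in `[0, 2 * pi]) G (set_coord x j t))%R
        g (enum 'I_N) 0.

Definition torus_int f : R[i] := torus_Rint (reF f) +i* torus_Rint (imF f).

Definition fourier_coef f xi : R[i] :=
  (((2 * pi) ^+ N)^-1)%:C * torus_int (fun x => expix (- xi) x * f x).

Definition enorm xi : R := Num.sqrt (\sum_(j < N) (xi 0 j)%:~R ^+ 2).

Definition fourier_psum f (k : nat) : 'rV[R]_N -> R[i] :=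
  fun x => \sum_(xi \in [set xi | enorm xi <= k%:R])
             (fourier_coef f xi * expix xi x).

End Torus.

(* Main.v *)
Require Import Defs.
From mathcomp Require Import all_boot all_order all_algebra.
From mathcomp Require Import complex.
From mathcomp Require Import all_classical all_reals all_analysis.
From mathcomp Require Import ring lra zify.
Import Order.TTheory GRing.Theory Num.Theory.
Import numFieldNormedType.Exports.
Local Open Scope classical_set_scope.
Local Open Scope ring_scope.
Local Open Scope complex_scope.

(** Everything rests on the decay of the Fourier coefficients.  Integration by
    parts turns D_j into multiplication by xi_j ([fourier_coef_Dop]).  Taking n
    derivatives in the direction of the dominant coordinate of xi, and bounding
    that derivative by C h^n m_n n!, gives
      (1 + |xi|)^n |phi^(xi)| <= C' A^n m_n n!      for all n and xi,
    which is the estimate with the infimum ([E_M_coef_decay]).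

    For the convergence, D^alpha phi has coefficients xi^alpha phi^(xi).  Using
    the decay with n = |alpha| + 2N + 1, and splitting m_n and n! by
    m_(j+k) <= H^(j+k) m_j m_k and (j+k)! <= 2^(j+k) j! k!, the sum over
    |xi| > k of |xi^alpha phi^(xi)| is at most
      C'' T^|alpha| m_|alpha| |alpha|! / (k + 1),
    with C'' and T independent of alpha: one power of 1 + |xi| pays for the
    factor 1 / (k + 1), and the other 2N make the sum over the lattice finite
    ([lattice_tail]).  Hence, once D^alpha phi is known to be the sum of its
    Fourier series, the partial sums converge to phi in the norm of E_(M,h) for
    every h >= T ([E_M_psum_rate]).  This is stronger than convergence in the
    inductive limit: a basic neighbourhood of 0 contains a ball of each step
    E_(M,h_n), and h_n >= T for some n.

    It remains to see that a continuous function with summable coefficients is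
    the sum of its Fourier series.  The series converges uniformly to a
    continuous function with the same coefficients ([fourier_psum_rate]), so
    the point is that a continuous function is determined by its coefficients
    ([fourier_uniqueness]).  Since the integral over the torus is iterated, this
    reduces, one coordinate at a time, to the circle ([circle_uniqueness]).
    There, Korovkin's argument applies: u is orthogonal to the powers of
    1 + cos (t - t0), these concentrate at t0, and therefore u(t0) = 0. *)

(** * Integration over a period and trigonometry *)

Section CircleIntegral.
Context {R : realType}.
Implicit Types (f g u : R -> R) (t : R).

Definition circle_int f : R :=
  (\int[lebesgue_measure]_(t in `[0, 2 * pi]) f t)%R.

Lemma twopi_gt0 : 0 < 2 * pi :> R.
Proof. by rewrite mulr_gt0// pi_gt0. Qed.

Lemma circle_integrable f : continuous f ->
  lebesgue_measure.-integrable `[0, 2 * pi]%classic (EFin \o f).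
Proof.
move=> cf; apply: (@continuous_compact_integrable R f `[0, 2 * pi]%classic).
  exact: segment_compact.
exact: continuous_subspaceT.
Qed.

Lemma circle_intD f g : continuous f -> continuous g ->
  circle_int (fun t => f t + g t) = circle_int f + circle_int g.
Proof. by move=> cf cg; apply: RintegralD => //; exact: circle_integrable. Qed.

Lemma circle_intZ (a : R) f : continuous f ->
  circle_int (fun t => a * f t) = a * circle_int f.
Proof. by move=> cf; apply: RintegralZl => //; exact: circle_integrable. Qed.

Lemma le_circle_int f g : continuous f -> continuous g ->
  (forall t, f t <= g t) -> circle_int f <= circle_int g.
Proof.
by move=> cf cg fg; apply: le_Rintegral => //; exact: circle_integrable.
Qed.

Lemma circle_int_derive (F f : R -> R) : continuous f ->
  (forall t, is_derive t 1 F (f t)) -> circle_int f = F (2 * pi) - F 0.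
Proof.
move=> cf dF; have cF : continuous F.
  move=> t; apply: differentiable_continuous; apply/derivable1_diffP.
  exact: (@ex_derive _ _ _ _ _ _ _ (dF t)).
rewrite /circle_int /Rintegral (@continuous_FTC2 R f F) ?twopi_gt0//.
- exact: continuous_subspaceT.
- split.
  + by move=> t _; exact: (@ex_derive _ _ _ _ _ _ _ (dF t)).
  + exact/cvg_at_right_filter/cF.
  + exact/cvg_at_left_filter/cF.
- by move=> t _; rewrite derive1E; exact: (@derive_val _ _ _ _ _ _ _ (dF t)).
Qed.

Lemma circle_int_cst (a : R) : circle_int (fun=> a) = 2 * pi * a.
Proof.
have dF t : is_derive t 1 (fun s : R => a * s) a.
  by have := is_deriveZ a (@is_derive_id R _ t 1); rewrite [a *: 1]mulr1.
rewrite (@circle_int_derive (fun s => a * s) (fun=> a) _ dF).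
  by rewrite mulr0 subr0 mulrC.
by move=> t; exact: cst_continuous.
Qed.

Lemma norm_circle_int_le f g : continuous f -> continuous g ->
  (forall t, `|f t| <= g t) -> `|circle_int f| <= circle_int g.
Proof.
move=> cf cg fg; apply: (@le_trans _ _ (circle_int (fun t => `|f t|))).
  by apply: le_normr_Rintegral => //; exact: circle_integrable.
apply: le_circle_int => //.
by move=> t; apply: continuous_comp; [exact: cf | exact: norm_continuous].
Qed.

Lemma circle_int_bound f (B : R) : continuous f ->
  (forall t, `|f t| <= B) -> `|circle_int f| <= 2 * pi * B.
Proof.
move=> cf fB; rewrite -circle_int_cst; apply: norm_circle_int_le => //.
by move=> t; exact: cst_continuous.
Qed.

End CircleIntegral.

Section Trigonometry.
Context {R : realType}.

Lemma cosD2piz (t : R) (k : int) : cos (t + 2 * pi * k%:~R) = cos t.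
Proof.
have P n (a : R) : cos (a + 2 * pi * n%:R) = cos a.
  by rewrite mulr_natr mulr_natl; exact: (periodicn (@cosD2pi R)).
case: k => n; first exact: P.
by rewrite NegzE rmorphN/= -[LHS](P n.+1) -addrA mulrN addNr addr0.
Qed.

Lemma sinD2piz (t : R) (k : int) : sin (t + 2 * pi * k%:~R) = sin t.
Proof.
have P n (a : R) : sin (a + 2 * pi * n%:R) = sin a.
  by rewrite mulr_natr mulr_natl; exact: (periodicn (@sinD2pi R)).
case: k => n; first exact: P.
by rewrite NegzE rmorphN/= -[LHS](P n.+1) -addrA mulrN addNr addr0.
Qed.

Lemma near_multiple_2pi (t : R) : exists k : int, `|t - 2 * pi * k%:~R| <= pi.
Proof.
have p0 := @pi_gt0 R.
exists (Num.floor ((t + pi) / (2 * pi))).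
have := floor_itv ((t + pi) / (2 * pi)); rewrite intrD.
set k := (_)%:~R => /andP[]; rewrite ler_pdivlMr ?twopi_gt0// => h1.
rewrite ltr_pdivrMr ?twopi_gt0// => h2.
by rewrite ler_norml; apply/andP; split; lra.
Qed.

Lemma cos_le_cos (d s : R) : 0 <= d -> d <= `|s| -> `|s| <= pi ->
  cos s <= cos d.
Proof.
move=> d0 ds sp; rewrite -(cos_norm s) leNgt ltr_cos -?leNgt//.
- by rewrite in_itv /= normr_ge0.
- by rewrite in_itv /= d0 (le_trans ds).
Qed.

Lemma cos_lt1 (d : R) : 0 < d -> d <= pi -> cos d < 1.
Proof.
move=> d0 dp; rewrite -(@cos0 R) ltr_cos// in_itv /= ?lexx ?pi_ge0//.
by rewrite ltW.
Qed.

End Trigonometry.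

(** * Uniqueness of Fourier coefficients on the circle *)

Section CircleUniqueness.
Context {R : realType}.
Implicit Types (u : R -> R) (t : R).

Lemma continuous_cos_affine (a b : R) : continuous (fun t => cos (a * t + b)).
Proof.
move=> t; apply: continuous_comp; last exact: continuous_cos.
apply: cvgD; last exact: cvg_cst.
by apply: cvgM; [exact: cvg_cst|exact: cvg_id].
Qed.

Lemma continuous_fctM {T : topologicalType} (f g : T -> R) :
  continuous f -> continuous g -> continuous (fun x : T => f x * g x).
Proof. by move=> cf cg x; exact: cvgM (cf x) (cg x). Qed.

Lemma continuous_fctD (f g : R -> R) : continuous f -> continuous g ->
  continuous (fun t => f t + g t).
Proof. by move=> cf cg t; apply: cvgD; [exact: cf|exact: cg]. Qed.

Lemma continuous_fctZ (a : R) (f : R -> R) : continuous f ->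
  continuous (fun t => a * f t).
Proof. by apply: continuous_fctM => t; exact: cst_continuous. Qed.

Lemma continuous_fctX (f : R -> R) n : continuous f ->
  continuous (fun t => f t ^+ n).
Proof.
move=> cf; elim: n => [|n IH]; first by move=> t; exact: cst_continuous.
have -> : (fun t => f t ^+ n.+1) = (fun t => f t * f t ^+ n).
  by apply/funext => t; rewrite exprS.
exact: continuous_fctM.
Qed.

(** Its powers are unnormalized positive kernels that concentrate at [t0]; they
    are trigonometric polynomials, so orthogonality to all frequencies passes to
    them. *)
Definition bump (t0 t : R) : R := 1 + cos (t - t0).

Lemma continuous_bump t0 : continuous (bump t0).
Proof.
apply: (continuous_fctD (fun=> 1)); first by move=> t; exact: cst_continuous.
have -> : (fun t => cos (t - t0)) = (fun t => cos (1 * t + - t0)).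
  by apply/funext => t; rewrite mul1r.
exact: continuous_cos_affine.
Qed.

Lemma bump_ge0 t0 t : 0 <= bump t0 t.
Proof. by rewrite /bump; have := cos_geN1 (t - t0); lra. Qed.

Definition bump_mass (t0 : R) n : R := circle_int (fun t => bump t0 t ^+ n).

(** The left-hand side minus the right-hand side is the integral over a period
    of the derivative of sin (t - t0) times the n-th power of the bump.  It gives the exact mass of [2 - bump], that is of 1 - cos (t - t0),
    against the n-th kernel: the fraction 1 / (n + 1) of the total mass. *)
Lemma bump_mass_rec t0 n :
  n.+1%:R * bump_mass t0 n.+1 = n.*2.+1%:R * bump_mass t0 n.
Proof.
have cK k := continuous_fctX _ k (continuous_bump t0).
pose f t := n.+1%:R * bump t0 t ^+ n.+1 + - n.*2.+1%:R * bump t0 t ^+ n.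
pose F t := sin (t - t0) * bump t0 t ^+ n.
have cf : continuous f.
  by apply: continuous_fctD; exact: continuous_fctZ.
have dF t : is_derive t 1 F (f t).
  have dB : is_derive t 1 (fun s : R => s - t0) 1 by exact: is_derive_shift.
  have dS : is_derive t 1 (fun s => sin (s - t0)) (cos (t - t0)).
    have := @is_derive1_comp R sin (fun s => s - t0) t _ _ (is_derive_sin _) dB.
    by rewrite mulr1.
  have dC : is_derive t 1 (fun s => cos (s - t0)) (- sin (t - t0)).
    have := @is_derive1_comp R cos (fun s => s - t0) t _ _ (is_derive_cos _) dB.
    by rewrite mulr1.
  have dK : is_derive t 1 (bump t0) (- sin (t - t0)).
    by have := is_deriveD (is_derive_cst (1 : R) t 1) dC; rewrite add0r.
  have dKn := is_deriveX n dK.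
  have XE x : (bump t0 ^+ n) x = bump t0 x ^+ n by rewrite exprfctE.
  have -> : F = (fun s => sin (s - t0)) * (bump t0 ^+ n).
    by apply/funext => s; rewrite /F [RHS]/(_ * _) XE.
  apply: is_derive_eq (is_deriveM dS dKn) _.
  rewrite XE /f /bump /GRing.scale /= -[n.*2]muln2 -![_.+1%:R]natr1 natrM.
  have := cos2Dsin2 (t - t0); set c := cos _; set s := sin _ => cs.
  move: n {f F cf dKn XE} => [|m]; first by rewrite !expr0 expr1 /=; lra.
  rewrite /= !exprS -!natr1; set p := (1 + c) ^+ m; set q := m%:R.
  have -> : s * ((q + 1) * p * - s) = - (s ^+ 2) * (q + 1) * p by ring.
  have -> : s ^+ 2 = 1 - c ^+ 2 by lra.
  by ring.
have := @circle_int_derive _ F f cf dF.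
rewrite /f circle_intD; last 2 first.
- exact: continuous_fctZ.
- exact: continuous_fctZ.
rewrite !circle_intZ// -!/(bump_mass _ _) /F /bump.
have -> : sin (2 * pi - t0) = sin (0 - t0).
  by rewrite sub0r -(sinD2piz (- t0) 1) mulr1 addrC.
have -> : cos (2 * pi - t0) = cos (0 - t0).
  by rewrite sub0r -(cosD2piz (- t0) 1) mulr1 addrC.
by rewrite subrr; lra.
Qed.

Lemma bump_mass_gt0 t0 n : 0 < bump_mass t0 n.
Proof.
elim: n => [|n IH].
  rewrite /bump_mass; under eq_fun do rewrite expr0.
  by rewrite circle_int_cst mulr1 twopi_gt0.
have := bump_mass_rec t0 n; set a := bump_mass t0 n.+1 => E.
have : 0 < n.+1%:R * a by rewrite E mulr_gt0.
by rewrite pmulr_rgt0.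
Qed.

(** Multiplication by the bump only shifts frequencies by -1, 0 and 1, so the
    vanishing of all moments is stable under it.  The phase [b] in the
    intermediate claim lets cosines and sines be handled together. *)
Lemma bump_moments u t0 : continuous u ->
  (forall k : int, circle_int (fun t => u t * cos (k%:~R * t)) = 0) ->
  (forall k : int, circle_int (fun t => u t * sin (k%:~R * t)) = 0) ->
  forall n, circle_int (fun t => u t * bump t0 t ^+ n) = 0.
Proof.
move=> cu uc us n.
suff P : forall (k : int) (b : R),
    circle_int (fun t => u t * bump t0 t ^+ n * cos (k%:~R * t + b)) = 0.
  rewrite -[RHS](P 0 0); congr circle_int; apply/funext => t.
  by rewrite mul0r addr0 cos0 mulr1.
have cK k := continuous_fctX _ k (continuous_bump t0).
elim: n => [|n IH] k b.
  have cs : continuous (fun t : R => sin (k%:~R * t)).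
    move=> t; apply: continuous_comp; last exact: continuous_sin.
    by apply: cvgM; [exact: cvg_cst|exact: cvg_id].
  have cc : continuous (fun t : R => cos (k%:~R * t)).
    have -> : (fun t : R => cos (k%:~R * t)) = (fun t => cos (k%:~R * t + 0)).
      by apply/funext => t; rewrite addr0.
    exact: continuous_cos_affine.
  transitivity (circle_int (fun t => cos b * (u t * cos (k%:~R * t))
     + (- sin b) * (u t * sin (k%:~R * t)))).
    by congr circle_int; apply/funext => t; rewrite expr0 cosD; ring.
  have cc' := continuous_fctM _ _ cu cc. have cs' := continuous_fctM _ _ cu cs.
  rewrite circle_intD; last 2 first.
  - exact: continuous_fctZ.
  - exact: continuous_fctZ.
  by rewrite !circle_intZ// uc us !mulr0 addr0.
have c3 (j : int) a := continuous_fctM _ _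
  (continuous_fctM _ _ cu (cK n)) (continuous_cos_affine j%:~R a).
transitivity (circle_int (fun t => u t * bump t0 t ^+ n * cos (k%:~R * t + b)
   + (2^-1 * (u t * bump t0 t ^+ n * cos ((k + 1)%:~R * t + (b - t0)))
   + 2^-1 * (u t * bump t0 t ^+ n * cos ((k - 1)%:~R * t + (b + t0)))))).
  congr circle_int; apply/funext => t; rewrite exprS.
  have -> : (k + 1)%:~R * t + (b - t0) = (k%:~R * t + b) + (t - t0).
    by rewrite intrD; ring.
  have -> : (k - 1)%:~R * t + (b + t0) = (k%:~R * t + b) - (t - t0).
    by rewrite intrB; ring.
  by rewrite /bump; set X := k%:~R * t + b; rewrite (cosD X) (cosB X); field.
have cZ (j : int) a :
    continuous (fun t => 2^-1 * (u t * bump t0 t ^+ n * cos (j%:~R * t + a))).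
  exact: continuous_fctZ.
rewrite !circle_intD//; last exact: continuous_fctD.
by rewrite !circle_intZ// !IH !mulr0 !addr0.
Qed.

(** Korovkin's argument.  By continuity and periodicity, u(t) is within
    e + C (1 - cos (t - t0)) of u(t0) for all t.  Integrating against the n-th
    power of the bump leaves |u(t0)| <= e + C / (n + 1). *)
Lemma circle_uniqueness u (M : R) : continuous u ->
  (forall t (k : int), u (t + 2 * pi * k%:~R) = u t) -> (forall t, `|u t| <= M) ->
  (forall k : int, circle_int (fun t => u t * cos (k%:~R * t)) = 0) ->
  (forall k : int, circle_int (fun t => u t * sin (k%:~R * t)) = 0) ->
  forall t, u t = 0.
Proof.
move=> cu up uM uc us t0; apply/eqP; rewrite -normr_le0 leNgt; apply/negP => ut0.
pose e := `|u t0| / 2; have e0 : 0 < e by rewrite divr_gt0.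
have p0 := @pi_gt0 R.
have [d [d0 dp ud]] : exists d : R, [/\ 0 < d, d <= pi &
    forall t, `|t - t0| < d -> `|u t0 - u t| <= e].
  have /cvgrPdist_le/(_ _ e0) := cu t0.
  move=> /nbhs_ballP[r /= r0 H]; exists (Num.min r pi); split.
  - by rewrite lt_min r0.
  - by rewrite ge_min lexx orbT.
  - move=> t; rewrite lt_min => /andP[tr _]; apply: H.
    by rewrite /ball /= distrC.
(* C (1 - cos s) exceeds the trivial bound 2 M as soon as d <= |s| <= pi. *)
pose C := 2 * M / (1 - cos d).
have cd : 0 < 1 - cos d by rewrite subr_gt0 cos_lt1.
have M0 : 0 <= M by rewrite (le_trans _ (uM 0)).
have C0 : 0 <= C by rewrite divr_ge0// ?mulr_ge0// ltW.
have key t : `|u t0 - u t| <= e + C * (2 - bump t0 t).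
  have [k kp] := near_multiple_2pi (t - t0).
  have -> : 2 - bump t0 t = 1 - cos (t - t0) by rewrite /bump; ring.
  rewrite -[u t](up t (- k)) -(cosD2piz (t - t0) (- k)).
  rewrite rmorphN/= mulrN.
  set s := _ - _ * _ in kp |- *.
  have -> : t - 2 * pi * k%:~R = t0 + s by rewrite /s; ring.
  have c1 : 0 <= C * (1 - cos s) by rewrite mulr_ge0// subr_ge0 cos_le1.
  have [sd|sd] := ltP `|s| d.
    by apply: (le_trans (ud _ _)); [rewrite addrC addKr|rewrite lerDl].
  have cs := cos_le_cos d s (ltW d0) sd kp.
  have h1 : `|u t0 - u (t0 + s)| <= 2 * M.
    by rewrite (le_trans (ler_normB _ _))// mulr_natl mulr2n lerD.
  apply: (le_trans h1); rewrite ler_wpDl ?(ltW e0)//.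
  have -> : 2 * M = C * (1 - cos d) by rewrite /C divfK ?gt_eqF.
  by rewrite ler_wpM2l// lerD2l lerN2.
have cK k := continuous_fctX _ k (continuous_bump t0).
have main n : `|u t0| * bump_mass t0 n <= (e + C / n.+1%:R) * bump_mass t0 n.
  have cUK := continuous_fctM _ _ cu (cK n).
  have c1 (v : R) k : continuous (fun t => v * bump t0 t ^+ k).
    exact: continuous_fctZ.
  have c2 : continuous (fun t => -1 * (u t * bump t0 t ^+ n)).
    exact: continuous_fctZ.
  have E : circle_int (fun t => u t0 * bump t0 t ^+ n + -1 * (u t * bump t0 t ^+ n))
     = u t0 * bump_mass t0 n.
    by rewrite circle_intD ?circle_intZ// ?(bump_moments u t0 cu uc us) ?mulr0 ?addr0.
  have F : circle_int (fun t => (e + C * 2) * bump t0 t ^+ n + - C * bump t0 t ^+ n.+1) =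
     (e + C / n.+1%:R) * bump_mass t0 n.
    rewrite circle_intD// !circle_intZ// -!/(bump_mass _ _).
    have := bump_mass_rec t0 n; set a := bump_mass t0 n; set b := bump_mass _ _ => Eab.
    have n0 : n%:R + 1 != 0 :> R by rewrite natr1 pnatr_eq0.
    have -> : b = n.*2.+1%:R * a / n.+1%:R by rewrite -Eab mulrC mulKf// -natr1.
    rewrite -[n.*2]muln2 -![_.+1%:R]natr1 natrM.
    by field.
  rewrite -F -[bump_mass t0 n in X in X <= _]gtr0_norm ?bump_mass_gt0// -normrM -E.
  apply: norm_circle_int_le; [exact: continuous_fctD|exact: continuous_fctD|].
  move=> t; have k0 : 0 <= bump t0 t ^+ n by rewrite exprn_ge0// bump_ge0.
  rewrite mulN1r -mulrBl normrM [`|_ ^+ n|]ger0_norm// exprS.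
  apply: le_trans (ler_wpM2r k0 (key t)) _.
  by rewrite le_eqVlt; apply/orP; left; apply/eqP; ring.
have main' n : e <= C / n.+1%:R.
  have := main n; rewrite ler_pM2r ?bump_mass_gt0//.
  have -> : `|u t0| = e + e by rewrite /e; field.
  by rewrite lerD2l.
have := main' (Num.truncn (C / e)).
rewrite ler_pdivlMr ?ltr0n// mulrC -ler_pdivlMr// leNgt => /negP; apply.
by have := truncn_itv (divr_ge0 C0 (ltW e0)) => /andP[].
Qed.

End CircleUniqueness.

(** * Iterated integrals, one coordinate at a time *)

Section IteratedIntegral.
Context {R : realType} {N : nat}.
Local Notation V := 'rV[R]_N.
Implicit Types (F G : V -> R) (x y : V) (j k : 'I_N) (s : seq 'I_N).

Local Notation e_ j := (delta_mx 0 j : V).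

Lemma set_coordE x j t k : set_coord x j t 0 k = if k == j then t else x 0 k.
Proof. by rewrite mxE. Qed.

Lemma set_coord_id x j : set_coord x j (x 0 j) = x.
Proof. by apply/rowP => k; rewrite mxE; case: eqP => [->|]. Qed.

Lemma set_coord_shift x j t h : set_coord x j (t + h) = set_coord x j t + h *: e_ j.
Proof.
apply/rowP => k; rewrite !mxE eqxx /= eq_sym.
by rewrite [j == k]eq_sym; case: eqP => _; rewrite ?mulr1 ?mulr0 ?addr0.
Qed.

Lemma set_coord_shiftN x j k t h : k != j ->
  set_coord (x + h *: e_ j) k t = set_coord x k t + h *: e_ j.
Proof.
move=> kj; apply/rowP => i; rewrite !mxE eqxx /=.
by case: eqP => [->|//]; rewrite (negPf kj) mulr0 addr0.
Qed.

(** Uniform continuity for the sup norm of coordinates.  Unlike continuity, it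
    passes through an integral in one coordinate by a one-line estimate, with no
    parametric-integral theorem. *)
Definition ucont F := forall e : R, 0 < e -> exists2 d : R, 0 < d &
  forall x y, (forall j, `|x 0 j - y 0 j| < d) -> `|F x - F y| <= e.

Lemma ucont_line F x j : ucont F -> continuous (fun t => F (set_coord x j t)).
Proof.
move=> uF t; apply/cvgrPdist_le => e e0; have [d d0 H] := uF e e0.
apply/nbhs_ballP; exists d => // u; rewrite /ball /= => tu; apply: H => k.
by rewrite !set_coordE; case: eqP => // _; rewrite subrr normr0.
Qed.

Lemma ucont_lin (a b : R) F G : ucont F -> ucont G ->
  ucont (fun x => a * F x + b * G x).
Proof.
move=> uF uG e e0.
have p0 : 0 < `|a| + `|b| + 1 by rewrite ltr_wpDl// addr_ge0.
have [d d0 H] := uF _ (divr_gt0 e0 p0). have [d' d'0 H'] := uG _ (divr_gt0 e0 p0).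
exists (Num.min d d'); first by rewrite lt_min d0.
move=> x y xy.
have h1 : `|F x - F y| <= e / (`|a| + `|b| + 1).
  by apply: H => j; have := xy j; rewrite lt_min => /andP[].
have h2 : `|G x - G y| <= e / (`|a| + `|b| + 1).
  by apply: H' => j; have := xy j; rewrite lt_min => /andP[].
have -> : a * F x + b * G x - (a * F y + b * G y) =
  a * (F x - F y) + b * (G x - G y) by ring.
apply: (le_trans (ler_normD _ _)); rewrite !normrM.
apply: (@le_trans _ _ (`|a| * (e / (`|a| + `|b| + 1)) + `|b| * (e / (`|a| + `|b| + 1)))).
  by apply: lerD; apply: ler_wpM2l.
rewrite -mulrDl mulrA ler_pdivrMr// mulrC ler_pM2l//.
by lra.
Qed.

(** One step of the iterated integral [torus_Rint]: integration in the j-th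
    coordinate, the result being still viewed as a function of all
    coordinates. *)
Definition coord_int j F x : R := circle_int (fun t => F (set_coord x j t)).
Definition coord_ints s F : V -> R := foldr coord_int F s.

Lemma coord_ints_cons j s F : coord_ints (j :: s) F = coord_int j (coord_ints s F).
Proof. by []. Qed.

Lemma coord_int_lin j (a b : R) F G : ucont F -> ucont G ->
  coord_int j (fun x => a * F x + b * G x) =
  (fun x => a * coord_int j F x + b * coord_int j G x).
Proof.
move=> uF uG; apply/funext => x; rewrite /coord_int.
have cF := ucont_line F x j uF. have cG := ucont_line G x j uG.
by rewrite circle_intD ?circle_intZ//; exact: continuous_fctZ.
Qed.

Lemma coord_int_bound j F x (B : R) : ucont F -> (forall y, `|F y| <= B) ->
  `|coord_int j F x| <= 2 * pi * B.
Proof. by move=> uF FB; apply: circle_int_bound => //; exact: ucont_line. Qed.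

Lemma coord_int_dist j F G x y (B : R) : ucont F -> ucont G ->
  (forall t, `|F (set_coord x j t) - G (set_coord y j t)| <= B) ->
  `|coord_int j F x - coord_int j G y| <= 2 * pi * B.
Proof.
move=> uF uG FB; rewrite /coord_int.
have cF := ucont_line F x j uF. have cG := ucont_line G y j uG.
have cG' : continuous (fun t => -1 * G (set_coord y j t)).
  exact: continuous_fctZ.
rewrite -mulN1r -circle_intZ// -circle_intD//.
apply: circle_int_bound; first exact: continuous_fctD.
by move=> t; rewrite mulN1r.
Qed.

Lemma coord_int_ucont j F : ucont F -> ucont (coord_int j F).
Proof.
move=> uF e e0; have [d d0 H] := uF _ (divr_gt0 e0 (@twopi_gt0 R)).
exists d => // x y xy.
have -> : e = 2 * pi * (e / (2 * pi)) by rewrite mulrC divfK// gt_eqF// twopi_gt0.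
apply: coord_int_dist => // t; apply: H => k; rewrite !set_coordE.
by case: eqP => // _; rewrite subrr normr0.
Qed.

Lemma coord_ints_ucont s F : ucont F -> ucont (coord_ints s F).
Proof. by move=> uF; elim: s => //= j s; exact: coord_int_ucont. Qed.

Lemma coord_ints_lin s (a b : R) F G : ucont F -> ucont G ->
  coord_ints s (fun x => a * F x + b * G x) =
  (fun x => a * coord_ints s F x + b * coord_ints s G x).
Proof.
move=> uF uG; elim: s => [//|j s IH].
by rewrite !coord_ints_cons IH coord_int_lin//; exact: coord_ints_ucont.
Qed.

Lemma coord_ints_bound s F (B : R) : ucont F -> (forall y, `|F y| <= B) ->
  forall x, `|coord_ints s F x| <= (2 * pi) ^+ size s * B.
Proof.
move=> uF FB; elim: s => [|j s IH] x /=; first by rewrite mul1r.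
by rewrite exprS -mulrA; apply: coord_int_bound => //; exact: coord_ints_ucont.
Qed.

Lemma coord_ints_cst s (a : R) : coord_ints s (fun=> a) = (fun=> (2 * pi) ^+ size s * a).
Proof.
elim: s => [|j s IH]; first by apply/funext => x; rewrite mul1r.
rewrite coord_ints_cons IH; apply/funext => x.
by rewrite /coord_int circle_int_cst exprS mulrA.
Qed.

Lemma coord_int_factor j (c : V -> R) F : ucont F ->
  (forall x t, c (set_coord x j t) = c x) ->
  coord_int j (fun x => c x * F x) = (fun x => c x * coord_int j F x).
Proof.
move=> uF cj; apply/funext => x; rewrite /coord_int -circle_intZ.
  by congr circle_int; apply/funext => t; rewrite cj.
exact: ucont_line.
Qed.

Lemma coord_ints_dep s F x y : (forall k, k \notin s -> x 0 k = y 0 k) ->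
  coord_ints s F x = coord_ints s F y.
Proof.
elim: s x y => [|j s IH] x y xy /=.
  by congr F; apply/rowP => k; exact: xy.
rewrite /coord_int; congr circle_int; apply/funext => t; apply: IH => k ks.
rewrite !set_coordE; case: eqP => // /eqP kj; apply: xy.
by rewrite in_cons negb_or kj.
Qed.

(** [F'] is the partial derivative of [F] and the difference quotients converge
    uniformly.  Uniformity makes the notion stable under integration in another
    coordinate, which replaces both differentiation under the integral sign and
    Fubini's theorem. *)
Definition upartial j F F' := forall e : R, 0 < e -> exists2 d : R, 0 < d &
  forall x h, `|h| < d -> `|F (x + h *: e_ j) - F x - h * F' x| <= e * `|h|.

Lemma coord_int_upartial j k F F' : k != j -> ucont F -> ucont F' ->
  upartial j F F' -> upartial j (coord_int k F) (coord_int k F').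
Proof.
move=> kj uF uF' FF' e e0.
have [d d0 H] := FF' _ (divr_gt0 e0 (@twopi_gt0 R)).
exists d => // x h hd.
have -> : e * `|h| = 2 * pi * (e / (2 * pi) * `|h|).
  by rewrite mulrA [2 * pi * _]mulrC divfK// gt_eqF// twopi_gt0.
have -> : coord_int k F (x + h *: e_ j) - coord_int k F x - h * coord_int k F' x =
   coord_int k F (x + h *: e_ j) - coord_int k (fun x => 1 * F x + h * F' x) x.
  by rewrite coord_int_lin//; ring.
apply: coord_int_dist => //; first exact: ucont_lin.
by move=> t; rewrite set_coord_shiftN// mul1r opprD addrA; exact: H.
Qed.

Lemma is_derive1_le (g : R -> R) (t l : R) :
  (forall e : R, 0 < e -> exists2 d : R, 0 < d &
    forall h, `|h| < d -> `|g (t + h) - g t - h * l| <= e * `|h|) ->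
  is_derive t 1 g l.
Proof.
move=> H.
have C : h^-1 *: ((g \o shift t) (h *: 1) - g t) @[h --> 0^'] --> l.
  apply/cvgrPdist_le => e e0; have [d d0 Hd] := H e e0.
  apply/nbhs_ballP; exists d => // h; rewrite /ball /= sub0r normrN => hd h0.
  have hn : 0 < `|h| by rewrite normr_gt0.
  rewrite -(ler_pM2r hn) -normrM (le_trans _ (Hd h hd))//.
  rewrite le_eqVlt; apply/orP; left; apply/eqP; rewrite -[LHS]normrN; congr `|_|.
  rewrite /GRing.scale /= /shift /= mulr1 [h + t]addrC.
  by field.
by split; [apply: cvgP C|apply: cvg_lim C].
Qed.

(** The fundamental theorem of calculus over a period. *)
Lemma coord_int_upartial_same j F F' : ucont F' -> upartial j F F' ->
  (forall x, F (x + (2 * pi) *: e_ j) = F x) -> coord_int j F' = fun=> 0.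
Proof.
move=> uF' FF' per; apply/funext => x.
have dF (t : R) : is_derive t 1 (fun u : R => F (set_coord x j u)) (F' (set_coord x j t)).
  apply: is_derive1_le => e e0; have [d d0 H] := FF' _ e0.
  by exists d => // h hd; rewrite set_coord_shift; exact: H.
rewrite /coord_int (@circle_int_derive _ _ _ (ucont_line F' x j uF') dF).
by rewrite -[2 * pi]add0r set_coord_shift per subrr.
Qed.

Lemma coord_ints_shift s j (h : R) F : j \notin s ->
  (forall x, F (x + h *: e_ j) = F x) ->
  forall x, coord_ints s F (x + h *: e_ j) = coord_ints s F x.
Proof.
elim: s => [//|i s IH]; rewrite in_cons negb_or => /andP[ji js] per x.
rewrite !coord_ints_cons /coord_int; congr circle_int; apply/funext => t.
by rewrite set_coord_shiftN 1?eq_sym// IH.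
Qed.

(** The integrals performed before the j-th one commute with the partial
    derivative, the j-th one kills it, and the remaining ones integrate 0. *)
Lemma coord_ints_upartial s j F F' : uniq s -> j \in s -> ucont F -> ucont F' ->
  upartial j F F' -> (forall x, F (x + (2 * pi) *: e_ j) = F x) ->
  coord_ints s F' = fun=> 0.
Proof.
move=> us js uF uF' FF' per; elim: s us js => [//|k s IH] /andP[ks us].
rewrite in_cons coord_ints_cons => /orP[/eqP jk|js]; last first.
  by rewrite IH//; apply/funext => x; rewrite /coord_int circle_int_cst mulr0.
have {}ks : j \notin s by rewrite jk.
rewrite -jk; apply: (@coord_int_upartial_same j (coord_ints s F)).
  exact: coord_ints_ucont.
  elim: s {IH us} ks => [//|i s IH]; rewrite in_cons negb_or => /andP[ji js].
  by apply: coord_int_upartial (IH js); rewrite 1?eq_sym//; exact: coord_ints_ucont.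
exact: coord_ints_shift.
Qed.

End IteratedIntegral.

(** * Continuous periodic functions *)

Section PeriodicFunctions.
Context {R : realType} {N : nat}.
Local Notation V := 'rV[R]_N.
Implicit Types (F G : V -> R) (x y : V) (j k : 'I_N) (xi : 'rV[int]_N).

Local Notation e_ j := (delta_mx 0 j : V).

Definition period xi : V := (2 * pi) *: map_mx intr xi.
Definition lattice_periodic {T : Type} (f : V -> T) := forall x xi, f (x + period xi) = f x.

Lemma periodE xi j : period xi 0 j = 2 * pi * (xi 0 j)%:~R.
Proof. by rewrite !mxE. Qed.

Lemma period_delta j : period (delta_mx 0 j) = (2 * pi) *: e_ j.
Proof.
by apply/rowP => k; rewrite periodE !mxE; case: (_ && _).
Qed.

Lemma reduce_mod_period x : exists xi, forall j, 0 <= (x + period xi) 0 j <= 2 * pi.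
Proof.
have p0 := @twopi_gt0 R.
exists (\row_j - Num.floor (x 0 j / (2 * pi))) => j; rewrite mxE periodE mxE.
have /andP[] := floor_itv (x 0 j / (2 * pi)); rewrite rmorphN intrD /=.
set k := (_)%:~R; rewrite ler_pdivlMr// => h1; rewrite ltr_pdivrMr// => h2.
by apply/andP; split; lra.
Qed.

Definition cell : set V := [set x | forall j, `[0, 2 * pi]%classic (x 0 j)].

Lemma compact_cell : compact cell.
Proof.
exact: (@rV_compact R N (fun=> `[0, 2 * pi]%classic)
  (fun=> @segment_compact R 0 (2 * pi))).
Qed.

Lemma periodic_bounded F : continuous F -> lattice_periodic F ->
  exists B : R, forall x, `|F x| <= B.
Proof.
move=> cF pF.
have /compact_bounded[M [_ HM]] : compact (F @` cell) :=
  continuous_compact (continuous_subspaceT cF) compact_cell.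
exists (M + 1) => x.
have [xi xiP] := reduce_mod_period x; rewrite -(pF x xi).
apply: (HM (M + 1)); first by rewrite ltrDl.
by exists (x + period xi) => // j; rewrite /= in_itv /=.
Qed.

(** Heine's theorem, with the compact cell of the lattice: near a point of the
    cell one radius works for all close enough points, and the covering property
    gives one radius for the whole cell.  Periodicity then moves any pair of
    points so that the first one lies in the cell. *)
Lemma periodic_ucont F : continuous F -> lattice_periodic F -> ucont F.
Proof.
move=> cF pF e e0.
pose P (d : R) x := forall y, (forall j, `|x 0 j - y 0 j| < d) -> `|F x - F y| <= e.
have cov : \forall d \near (0 : R)^'+, cell `<=` P d.
  have /compact_near_coveringP H := compact_cell.
  apply: H => x _.
  have /cvgrPdist_lt/(_ (e / 2)) := cF x.
  rewrite divr_gt0// => /(_ isT) /nbhs_ballP[r /= r0 Hr].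
  have r2 : 0 < r / 2 by rewrite divr_gt0.
  exists (ball x (r / 2), [set d | d < r / 2]).
    split; first exact: nbhsx_ballx.
    exact: nbhs_right_lt.
  move=> [z d] /= [[_ xz] dr] y zy.
  have h1 : `|F x - F z| < e / 2.
    apply: Hr; split => // i j; apply: le_ball (xz i j).
    by rewrite ler_pdivrMr// ler_peMr// ?ltW// (ltr_nat R 1 2).
  have h2 : `|F x - F y| < e / 2.
    apply: Hr; split => // i j; rewrite ord1 [r]splitr.
    apply: ball_triangle (xz ord0 j) _; rewrite /ball /=.
    by apply: lt_le_trans (zy j) _; exact: ltW.
  rewrite ltW// [e]splitr; have -> : F z - F y = - (F x - F z) + (F x - F y) by ring.
  by rewrite (le_lt_trans (ler_normD _ _))// normrN ltrD.
have /filterI/(_ cov) := @nbhs_right_gt R 0.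
move=> /filter_ex[d [d0 cd]]; exists d => // x y xy.
have [xi xiP] := reduce_mod_period x; rewrite -(pF x xi) -(pF y xi).
apply: cd => [j|j]; first by rewrite /= in_itv /=.
by rewrite !mxE opprD addrACA subrr addr0.
Qed.

Lemma line_shiftE x j (t h : R) : h *: e_ j + (x + t *: e_ j) = x + (h + t) *: e_ j.
Proof. by rewrite scalerDl addrCA. Qed.

(** Reduces directional derivatives to derivatives of functions of one real
    variable, to which the mean value theorem applies. *)
Lemma is_derive_line F x j (t d : R) :
  is_derive (x + t *: e_ j) (e_ j) F d <->
  is_derive (t : R) (1 : R) (fun u : R => F (x + u *: e_ j)) d.
Proof.
have E : (fun h : R => h^-1 *: ((F \o shift (x + t *: e_ j)) (h *: e_ j) - F (x + t *: e_ j)))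
  = (fun h : R => h^-1 *: (((fun u : R => F (x + u *: e_ j)) \o shift t) (h *: (1 : R))
      - F (x + t *: e_ j))).
  by apply/funext => h /=; rewrite /shift /= line_shiftE [h *: 1]mulr1.
split=> -[D1 D2]; split.
- by rewrite /derivable -E.
- by rewrite /derive -E.
- by rewrite /derivable E.
- by rewrite /derive E.
Qed.

(** By the mean value theorem the error of the difference quotient is the
    oscillation of [F'] at distance |h|, which uniform continuity controls. *)
Lemma periodic_upartial j F F' : continuous F' -> lattice_periodic F' ->
  (forall x, is_derive x (e_ j) F (F' x)) -> upartial j F F'.
Proof.
move=> cF' pF' dF e e0; have [d d0 H] := periodic_ucont F' cF' pF' e e0.
exists d => // x h hd.
pose g (u : R) := F (x + u *: e_ j).
have dg (u : R) : is_derive u (1 : R) g (F' (x + u *: e_ j)).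
  by apply/is_derive_line; exact: dF.
have cg : continuous g.
  move=> t; apply: differentiable_continuous; apply/derivable1_diffP.
  exact: (@ex_derive _ _ _ _ _ _ _ (dg t)).
suff [c ch ->] : exists2 c : R, `|c| <= `|h| &
    F (x + h *: e_ j) - F x = F' (x + c *: e_ j) * h.
  rewrite [_ * h]mulrC -mulrBr normrM mulrC ler_wpM2r// ; apply: H => k.
  rewrite !mxE eqxx /= addrAC subrr add0r normrM.
  rewrite (le_lt_trans _ hd)// (le_trans _ ch)// ler_piMr//.
  by case: eqP; rewrite ?normr1 ?normr0.
have Fx : F x = g 0 by rewrite /g scale0r addr0.
rewrite Fx -/(g h); have [h0|h0] := leP 0 h.
  have [c + ->] := @MVT_segment R g _ 0 h h0 (fun u _ => dg u) (continuous_subspaceT cg).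
  rewrite in_itv /= => /andP[c0 ch]; exists c; last by rewrite subr0.
  by rewrite !ger0_norm.
have [c + E] := @MVT_segment R g _ h 0 (ltW h0) (fun u _ => dg u) (continuous_subspaceT cg).
rewrite in_itv /= => /andP[ch c0]; exists c.
  by rewrite (ler0_norm c0) (ltr0_norm h0) lerN2.
by rewrite -opprB E; ring.
Qed.

Lemma torus_Rint_derive j F F' : continuous F -> lattice_periodic F ->
  continuous F' -> lattice_periodic F' ->
  (forall x, is_derive x (e_ j) F (F' x)) -> torus_Rint F' = 0.
Proof.
move=> cF pF cF' pF' dF.
have := @coord_ints_upartial R N (enum 'I_N) j F F' (enum_uniq _) (mem_enum _ _).
rewrite /torus_Rint => /(_ _ _ _ _)/(congr1 (@^~ 0)) H; apply: H.
- exact: periodic_ucont.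
- exact: periodic_ucont.
- exact: periodic_upartial.
- by move=> x; rewrite -period_delta pF.
Qed.

End PeriodicFunctions.

(** * Smooth functions and characters *)

Section SmoothFunctions.
Context {R : realType} {N : nat}.
Local Notation V := 'rV[R]_N.
Implicit Types (F G : V -> R) (f g : V -> R[i]) (x y : V) (j k : 'I_N)
  (xi : 'rV[int]_N) (s : seq 'I_N).

Local Notation e_ j := (delta_mx 0 j : V).
Local Notation C := R[i].

Lemma continuous_lin (a b : R) F G : continuous F -> continuous G ->
  continuous (fun x => a * F x + b * G x).
Proof.
move=> cF cG x.
exact: cvgD (cvgM (cvg_cst a) (cF x)) (cvgM (cvg_cst b) (cG x)).
Qed.

(** The complex operations on the components of a function are real linear
    combinations of two terms, hence this common form. *)
Lemma is_derive_lin {W : normedModType R} (a b : R) (F G : W -> R) (x v : W) (dF dG : R) :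
  is_derive x v F dF -> is_derive x v G dG ->
  is_derive x v (fun w : W => a * F w + b * G w) (a * dF + b * dG).
Proof.
by move=> hF hG; exact: (is_deriveD (is_deriveZ a hF) (is_deriveZ b hG)).
Qed.

Lemma reF_scale (a : C) f : reF (fun x => a * f x) =
  fun x => complex.Re a * reF f x + - complex.Im a * imF f x.
Proof.
by apply/funext => x; rewrite /reF /imF; case: a (f x) => [p q] [u v] /=; rewrite mulNr.
Qed.

Lemma imF_scale (a : C) f : imF (fun x => a * f x) =
  fun x => complex.Im a * reF f x + complex.Re a * imF f x.
Proof.
by apply/funext => x; rewrite /reF /imF; case: a (f x) => [p q] [u v] /=; rewrite addrC.
Qed.

Lemma reFD f g : reF (fun x => f x + g x) = fun x => 1 * reF f x + 1 * reF g x.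
Proof.
by apply/funext => x; rewrite /reF !mul1r; case: (f x) (g x) => [p q] [u v].
Qed.

Lemma imFD f g : imF (fun x => f x + g x) = fun x => 1 * imF f x + 1 * imF g x.
Proof.
by apply/funext => x; rewrite /imF !mul1r; case: (f x) (g x) => [p q] [u v].
Qed.

Definition differentiable_dirs f := forall x j,
  derivable (reF f) x (e_ j) /\ derivable (imF f) x (e_ j).

Lemma is_derive_re j f x : differentiable_dirs f ->
  is_derive x (e_ j) (reF f) (reF (partial j f) x).
Proof. by move=> /(_ x j)[df _]; exact: derivableP. Qed.

Lemma is_derive_im j f x : differentiable_dirs f ->
  is_derive x (e_ j) (imF f) (imF (partial j f) x).
Proof. by move=> /(_ x j)[_ df]; exact: derivableP. Qed.

Lemma partialE j f f' : (forall x, is_derive x (e_ j) (reF f) (reF f' x)) ->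
  (forall x, is_derive x (e_ j) (imF f) (imF f' x)) -> partial j f = f'.
Proof.
move=> re im; apply/funext => x; rewrite /partial.
rewrite (@derive_val _ _ _ _ _ _ _ (re x)) (@derive_val _ _ _ _ _ _ _ (im x)).
by rewrite /reF /imF; case: (f' x).
Qed.

Lemma partialZ j (a : C) f : differentiable_dirs f ->
  partial j (fun x => a * f x) = fun x => a * partial j f x.
Proof.
move=> df; apply: partialE => x.
  by rewrite !reF_scale; apply: is_derive_lin; [exact: is_derive_re|exact: is_derive_im].
by rewrite !imF_scale; apply: is_derive_lin; [exact: is_derive_re|exact: is_derive_im].
Qed.

Lemma partialD j f g : differentiable_dirs f -> differentiable_dirs g ->
  partial j (fun x => f x + g x) = fun x => partial j f x + partial j g x.
Proof.
move=> df dg; apply: partialE => x.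
  by rewrite !reFD; apply: is_derive_lin; exact: is_derive_re.
by rewrite !imFD; apply: is_derive_lin; exact: is_derive_im.
Qed.

Lemma smooth_dirs f : smooth f -> differentiable_dirs f.
Proof. by move=> /(_ [::])[]. Qed.

Lemma smooth_partial j f : smooth f -> smooth (partial j f).
Proof. by move=> sf s; have := sf (rcons s j); rewrite foldr_rcons. Qed.

Lemma smooth_foldr s f : smooth f -> smooth (foldr partial f s).
Proof. by move=> sf; elim: s => [|j s IH]; [exact: sf|exact: smooth_partial]. Qed.

(** To prove smoothness it suffices to exhibit the iterated derivatives in
    closed form. *)
Lemma smoothP f : (forall s, exists g, [/\ foldr partial f s = g,
   continuous (reF g), continuous (imF g) & differentiable_dirs g]) -> smooth f.
Proof. by move=> H s; have [g [-> ? ? ?]] := H s. Qed.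

Lemma smoothZ (a : C) f : smooth f -> smooth (fun x => a * f x).
Proof.
move=> sf; apply: smoothP => s; exists (fun x => a * foldr partial f s x).
have [cr ci d] := sf s; split.
- elim: s {cr ci d} => //= j s ->; apply: partialZ.
  exact/smooth_dirs/smooth_foldr.
- by rewrite reF_scale; exact: continuous_lin.
- by rewrite imF_scale; exact: continuous_lin.
- move=> x j; rewrite reF_scale imF_scale.
  split; apply: ex_derive; apply: is_derive_lin; by [exact: is_derive_re|exact: is_derive_im].
Qed.

Lemma smoothD f g : smooth f -> smooth g -> smooth (fun x => f x + g x).
Proof.
move=> sf sg; apply: smoothP => s.
exists (fun x => foldr partial f s x + foldr partial g s x).
have [cr ci d] := sf s; have [cr' ci' d'] := sg s; split.
- elim: s {cr ci d cr' ci' d'} => //= j s ->.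
  by apply: partialD; exact/smooth_dirs/smooth_foldr.
- by rewrite reFD; exact: continuous_lin.
- by rewrite imFD; exact: continuous_lin.
- move=> x j; rewrite reFD imFD.
  split; apply: ex_derive; apply: is_derive_lin; by [exact: is_derive_re|exact: is_derive_im].
Qed.

Definition phase xi x : R := \sum_(j < N) x 0 j * (xi 0 j)%:~R.

Lemma continuous_phase xi : continuous (phase xi).
Proof.
have cj j : continuous (fun x : V => x 0 j * (xi 0 j)%:~R).
  by move=> x; exact: cvgM (@coord_continuous R 1 N 0 j x) (cvg_cst _).
rewrite /phase; apply: (@continuous_big _ _ +%R 0) => [|j _]; last exact: cj.
by move=> p; exact: add_continuous.
Qed.

Lemma phase_shift xi x j (t : R) : phase xi (x + t *: e_ j) = t * (xi 0 j)%:~R + phase xi x.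
Proof.
rewrite /phase (bigD1 j)//= [in RHS](bigD1 j)//= !mxE !eqxx mulr1 mulrDl addrA.
congr +%R; first by rewrite addrC.
by apply: eq_bigr => k kj; rewrite !mxE (negPf kj) andbF mulr0 addr0.
Qed.

Lemma is_derive_phase xi x j : is_derive x (e_ j) (phase xi) (xi 0 j)%:~R.
Proof.
rewrite -[x]addr0 -(scale0r (e_ j)); apply/is_derive_line.
have -> : (fun u : R => phase xi (x + u *: e_ j)) =
   (fun u : R => (xi 0 j)%:~R * u + 1 * phase xi x).
  by apply/funext => u; rewrite phase_shift mul1r mulrC.
have := is_derive_lin (xi 0 j)%:~R 1 id (fun=> phase xi x) (0 : R) 1 1 0
  (is_derive_id _ _) (is_derive_cst _ _ _).
by rewrite !mulr1 mulr0 addr0.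
Qed.

Lemma expixD xi eta x : expix (xi + eta) x = expix xi x * expix eta x :> C.
Proof.
rewrite /expix -!/(phase _ _).
have -> : phase (xi + eta) x = phase xi x + phase eta x.
  rewrite /phase -big_split; apply: eq_bigr => j _.
  by rewrite mxE intrD mulrDr.
by rewrite cosD sinD; simpc; rewrite [sin _ * cos _ + _]addrC.
Qed.

Lemma expix0 x : expix 0 x = 1 :> C.
Proof.
rewrite /expix big1; first by rewrite cos0 sin0.
by move=> j _; rewrite mxE mulr0.
Qed.

Lemma normc_expix xi x : Normc.normc (expix xi x) = 1 :> R.
Proof. by rewrite /expix /= cos2Dsin2 sqrtr1. Qed.

Lemma expix_periodic xi : lattice_periodic (expix xi : V -> C).
Proof.
move=> x eta; rewrite /expix -!/(phase _ _).
have -> : phase xi (x + period eta) =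
    phase xi x + 2 * pi * (\sum_j xi 0 j * eta 0 j)%:~R.
  rewrite rmorph_sum /= mulr_sumr /phase -big_split; apply: eq_bigr => j _.
  by rewrite mxE periodE intrM /=; ring.
by rewrite cosD2piz sinD2piz.
Qed.

Lemma is_derive_expix xi x j :
  is_derive x (e_ j) (reF (expix xi)) (- (xi 0 j)%:~R * imF (expix xi) x) /\
  is_derive x (e_ j) (imF (expix xi)) ((xi 0 j)%:~R * reF (expix xi) x).
Proof.
have D (h : R -> R) d : is_derive (phase xi x) 1 h d ->
    is_derive x (e_ j) (fun y => h (phase xi y)) (d * (xi 0 j)%:~R).
  move=> dh; have E : x = x + 0 *: e_ j by rewrite scale0r addr0.
  rewrite E; apply/is_derive_line.
  apply: (@is_derive1_comp R h (fun u => phase xi (x + u *: e_ j))).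
    by rewrite -E.
  by apply/is_derive_line; exact: is_derive_phase.
split; first by rewrite mulNr mulrC -mulNr; exact: (D cos _ (is_derive_cos _)).
by rewrite mulrC; exact: (D sin _ (is_derive_sin _)).
Qed.

Lemma continuous_expix xi : continuous (reF (expix xi : V -> C)) /\
   continuous (imF (expix xi : V -> C)).
Proof.
split=> x.
  by apply: continuous_comp; [exact: continuous_phase|exact: continuous_cos].
by apply: continuous_comp; [exact: continuous_phase|exact: continuous_sin].
Qed.

Lemma dirs_expix xi : differentiable_dirs (expix xi).
Proof. by move=> x j; have [d1 d2] := is_derive_expix xi x j; split; apply: ex_derive. Qed.

Lemma partial_expix j xi : partial j (expix xi) = fun x => (0 +i* (xi 0 j)%:~R) * expix xi x.
Proof.
apply: partialE => x; have [d1 d2] := is_derive_expix xi x j.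
  by rewrite reF_scale /= mul0r add0r.
by rewrite imF_scale /= mul0r addr0.
Qed.

Lemma smooth_expix xi : smooth (expix xi : V -> C).
Proof.
apply: smoothP => s.
have [c ->] : exists c, foldr partial (expix xi) s = fun x => c * expix xi x.
  elim: s => [|j s [c /= ->]]; first by exists 1; apply/funext => x; rewrite mul1r.
  rewrite partialZ; last exact: dirs_expix.
  rewrite partial_expix; exists (c * (0 +i* (xi 0 j)%:~R)).
  by apply/funext => x; rewrite mulrA.
exists (fun x => c * expix xi x); have [cr ci] := continuous_expix xi; split=> //.
- by rewrite reF_scale; exact: continuous_lin.
- by rewrite imF_scale; exact: continuous_lin.
- move=> x j; have d := dirs_expix xi; rewrite reF_scale imF_scale.
  split; apply: ex_derive; apply: is_derive_lin; by [exact: is_derive_re|exact: is_derive_im].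
Qed.

End SmoothFunctions.

(** * Fourier coefficients of continuous functions *)

Section FourierCoefficients.
Context {R : realType} {N : nat}.
Local Notation V := 'rV[R]_N.
Implicit Types (F G : V -> R) (f g : V -> R[i]) (x y : V) (j k : 'I_N)
  (xi eta : 'rV[int]_N) (s : seq 'I_N).

Local Notation e_ j := (delta_mx 0 j : V).
Local Notation C := R[i].
Local Notation normc := Normc.normc.

Lemma normc_le_ReIm (z : C) : normc z <= `|complex.Re z| + `|complex.Im z|.
Proof.
case: z => a b /=; rewrite -[leRHS]ger0_norm ?addr_ge0// -sqrtr_sqr ler_wsqrtr//.
by rewrite sqrrD !real_normK ?num_real// addrAC lerDl mulrn_wge0// mulr_ge0.
Qed.

Lemma Re_le_normc (z : C) : `|complex.Re z| <= normc z.
Proof. by case: z => a b /=; rewrite -sqrtr_sqr ler_wsqrtr// lerDl sqr_ge0. Qed.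

Lemma Im_le_normc (z : C) : `|complex.Im z| <= normc z.
Proof. by case: z => a b /=; rewrite -sqrtr_sqr ler_wsqrtr// lerDr sqr_ge0. Qed.

Lemma reFM f g : reF (fun x => f x * g x) =
  fun x => 1 * (reF f x * reF g x) + -1 * (imF f x * imF g x).
Proof.
apply/funext => x; rewrite /reF /imF mul1r mulN1r.
by case: (f x) (g x) => [a b] [c d].
Qed.

Lemma imFM f g : imF (fun x => f x * g x) =
  fun x => 1 * (reF f x * imF g x) + 1 * (imF f x * reF g x).
Proof.
apply/funext => x; rewrite /reF /imF !mul1r.
by case: (f x) (g x) => [a b] [c d].
Qed.

(** The class on which Fourier coefficients behave well.  It contains the
    uniform limits of partial sums, which are not known to be smooth. *)
Definition torus_continuous f :=
  [/\ continuous (reF f), continuous (imF f) & lattice_periodic f].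

Lemma torus_continuousM f g : torus_continuous f -> torus_continuous g ->
  torus_continuous (fun x => f x * g x).
Proof.
move=> [a b c] [a' b' c']; split.
- by rewrite reFM; apply: continuous_lin; exact: continuous_fctM.
- by rewrite imFM; apply: continuous_lin; exact: continuous_fctM.
- by move=> x xi; rewrite c c'.
Qed.

Lemma torus_continuousZ (a : C) f : torus_continuous f ->
  torus_continuous (fun x => a * f x).
Proof.
move=> [cr ci p]; split.
- by rewrite reF_scale; exact: continuous_lin.
- by rewrite imF_scale; exact: continuous_lin.
- by move=> x xi; rewrite p.
Qed.

Lemma torus_continuousD f g : torus_continuous f -> torus_continuous g ->
  torus_continuous (fun x => f x + g x).
Proof.
move=> [a b c] [a' b' c']; split.
- by rewrite reFD; exact: continuous_lin.
- by rewrite imFD; exact: continuous_lin.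
- by move=> x xi; rewrite c c'.
Qed.

Lemma torus_continuous_expix xi : torus_continuous (expix xi).
Proof. by have [cr ci] := @continuous_expix R N xi; split=> //; exact: expix_periodic. Qed.

Lemma Cinfty_torus_continuous f : Cinfty_torus f -> torus_continuous f.
Proof. by move=> [p /(_ [::])[cr ci _]]; split. Qed.

Lemma lattice_re f : lattice_periodic f -> lattice_periodic (reF f).
Proof. by move=> p x xi; rewrite /reF p. Qed.

Lemma lattice_im f : lattice_periodic f -> lattice_periodic (imF f).
Proof. by move=> p x xi; rewrite /imF p. Qed.

Lemma torus_continuous_ucont f : torus_continuous f ->
  ucont (reF f) /\ ucont (imF f).
Proof.
by move=> [cr ci p]; split; apply: periodic_ucont => //; [exact: lattice_re|exact: lattice_im].
Qed.

Lemma partial_periodic j f : torus_periodic f -> torus_periodic (partial j f).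
Proof.
have D F : lattice_periodic F -> lattice_periodic (fun x => 'D_(e_ j) F x).
  move=> pF x xi; rewrite /derive.
  suff -> : (fun h : R => h^-1 *:
      ((F \o shift (x + period xi)) (h *: e_ j) - F (x + period xi)))
    = (fun h : R => h^-1 *: ((F \o shift x) (h *: e_ j) - F x)) by [].
  by apply/funext => h /=; rewrite /shift /= addrA !pF.
move=> p x xi; rewrite /partial; congr (_ +i* _).
  exact: (D _ (lattice_re _ p)).
exact: (D _ (lattice_im _ p)).
Qed.

Lemma Cinfty_torusZ (a : C) f : Cinfty_torus f -> Cinfty_torus (fun x => a * f x).
Proof. by move=> [p s]; split; [move=> x xi; rewrite p|exact: smoothZ]. Qed.

Lemma Cinfty_torusD f g : Cinfty_torus f -> Cinfty_torus g ->
  Cinfty_torus (fun x => f x + g x).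
Proof. by move=> [p s] [p' s']; split; [move=> x xi; rewrite p p'|exact: smoothD]. Qed.

Lemma Cinfty_torus_expix xi : Cinfty_torus (expix xi : V -> C).
Proof. by split; [exact: expix_periodic|exact: smooth_expix]. Qed.

Lemma Cinfty_torus_Dop j f : Cinfty_torus f -> Cinfty_torus (Dop j f).
Proof.
move=> [p s]; apply: Cinfty_torusZ.
by split; [exact: partial_periodic|exact: smooth_partial].
Qed.

(** The integral of a complex function, with a list of coordinates as a
    parameter so that one can induct on it; the full list gives [torus_int]. *)
Definition coord_intsC s f : V -> C :=
  fun x => coord_ints s (reF f) x +i* coord_ints s (imF f) x.

Lemma torus_intE f : torus_int f = coord_intsC (enum 'I_N) f 0.
Proof. by []. Qed.

Lemma coord_intsCZ s (a : C) f : torus_continuous f ->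
  coord_intsC s (fun x => a * f x) = fun x => a * coord_intsC s f x.
Proof.
move=> /torus_continuous_ucont[ur ui]; apply/funext => x.
rewrite /coord_intsC reF_scale imF_scale !coord_ints_lin//.
by case: a => p q /=; apply/eqP; rewrite eq_complex /=; apply/andP; split; apply/eqP; ring.
Qed.

Lemma coord_intsCD s f g : torus_continuous f -> torus_continuous g ->
  coord_intsC s (fun x => f x + g x) = fun x => coord_intsC s f x + coord_intsC s g x.
Proof.
move=> /torus_continuous_ucont[ur ui] /torus_continuous_ucont[ur' ui'].
apply/funext => x.
by rewrite /coord_intsC reFD imFD !coord_ints_lin// !mul1r; simpc.
Qed.

Lemma coord_ints_factor s (c F : V -> R) : ucont F ->
  (forall j x t, j \in s -> c (set_coord x j t) = c x) ->
  coord_ints s (fun x => c x * F x) = fun x => c x * coord_ints s F x.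
Proof.
move=> uF; elim: s => [//|j s IH] cs; rewrite !coord_ints_cons IH.
  by apply: coord_int_factor => [|x t]; [exact: coord_ints_ucont|rewrite cs// mem_head].
by move=> i x t si; rewrite cs// in_cons si orbT.
Qed.

Lemma coord_intsC_factor s (c : V -> C) f : torus_continuous c -> torus_continuous f ->
  (forall j x t, j \in s -> c (set_coord x j t) = c x) ->
  coord_intsC s (fun x => c x * f x) = fun x => c x * coord_intsC s f x.
Proof.
move=> [cr ci cp] [fr fi fp] cs.
have u F G : continuous F -> continuous G -> lattice_periodic F -> lattice_periodic G ->
    ucont (fun x => F x * G x).
  move=> cF cG pF pG; apply: periodic_ucont; first exact: continuous_fctM.
  by move=> x xi; rewrite pF pG.
have [rc ic] := (lattice_re _ cp, lattice_im _ cp).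
have [rf jf] := (lattice_re _ fp, lattice_im _ fp).
have [ur ui] := torus_continuous_ucont f (And3 fr fi fp).
have csr j x t : j \in s -> reF c (set_coord x j t) = reF c x.
  by move=> js; rewrite /reF cs.
have csi j x t : j \in s -> imF c (set_coord x j t) = imF c x.
  by move=> js; rewrite /imF cs.
apply/funext => x; rewrite /coord_intsC reFM imFM !coord_ints_lin; try exact: u.
rewrite !coord_ints_factor// /reF /imF; case: (c x) => p q /=.
by apply/eqP; rewrite eq_complex /=; apply/andP; split; apply/eqP; ring.
Qed.

Lemma normc_coord_intsC s f (B : R) : torus_continuous f -> (forall x, normc (f x) <= B) ->
  forall x, normc (coord_intsC s f x) <= 2 * ((2 * pi) ^+ size s * B).
Proof.
move=> /torus_continuous_ucont[ur ui] fB x; apply: (le_trans (normc_le_ReIm _)).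
rewrite mulr_natl mulr2n /=; apply: lerD; apply: coord_ints_bound => // y.
  exact: le_trans (Re_le_normc _) (fB y).
exact: le_trans (Im_le_normc _) (fB y).
Qed.

Local Notation kernel xi f := (fun x => expix (- xi) x * f x).

Lemma torus_continuous_kernel xi f : torus_continuous f -> torus_continuous (kernel xi f).
Proof. by apply: torus_continuousM; exact: torus_continuous_expix. Qed.

Lemma fourier_coefD f g xi : torus_continuous f -> torus_continuous g ->
  fourier_coef (fun x => f x + g x) xi = fourier_coef f xi + fourier_coef g xi.
Proof.
move=> cf cg; rewrite /fourier_coef !torus_intE -mulrDr.
have -> : kernel xi (fun x => f x + g x) = fun x => kernel xi f x + kernel xi g x.
  by apply/funext => x; rewrite mulrDr.
by rewrite coord_intsCD//; exact: torus_continuous_kernel.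
Qed.

Lemma fourier_coefZ (a : C) f xi : torus_continuous f ->
  fourier_coef (fun x => a * f x) xi = a * fourier_coef f xi.
Proof.
move=> cf; rewrite /fourier_coef !torus_intE.
have -> : kernel xi (fun x => a * f x) = fun x => a * kernel xi f x.
  by apply/funext => x; rewrite mulrCA.
by rewrite coord_intsCZ 1?mulrCA//; exact: torus_continuous_kernel.
Qed.

Lemma normc_real (a : R) : 0 <= a -> normc a%:C = a.
Proof. by move=> a0; rewrite /= expr0n addr0 sqrtr_sqr ger0_norm. Qed.

Lemma fourier_coef_bound f (B : R) xi : torus_continuous f ->
  (forall x, normc (f x) <= B) -> normc (fourier_coef f xi) <= 2 * B.
Proof.
move=> cf fB; rewrite /fourier_coef Normc.normcM.
have pN : 0 < (2 * pi) ^+ N :> R by rewrite exprn_gt0// twopi_gt0.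
rewrite normc_real ?invr_ge0 ?(ltW pN)// ler_pdivrMl// torus_intE.
have -> : (2 * pi) ^+ N * (2 * B) = 2 * ((2 * pi) ^+ size (enum 'I_N) * B).
  by rewrite size_enum_ord mulrCA.
apply: normc_coord_intsC; first exact: torus_continuous_kernel.
by move=> x; rewrite Normc.normcM normc_expix mul1r.
Qed.

(** Integration by parts: up to the factor i, the derivative of the product of
    [f] by the character is the integrand on the left minus xi_j times the one on
    the right, and its integral vanishes.  The two components are treated
    separately, the derivative of the real part giving the imaginary part of the
    identity and conversely. *)
Lemma fourier_coef_Dop j f xi : Cinfty_torus f ->
  fourier_coef (Dop j f) xi = (xi 0 j)%:~R * fourier_coef f xi.
Proof.
move=> Cf; have cf := Cinfty_torus_continuous _ Cf.
have cDf := Cinfty_torus_continuous _ (Cinfty_torus_Dop j _ Cf).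
have [cr ci p] := torus_continuous_kernel xi _ cf.
have [cr' ci' p'] := torus_continuous_kernel xi _ cDf.
have [ur ui] := torus_continuous_ucont _ (torus_continuous_kernel xi _ cf).
have [ur' ui'] := torus_continuous_ucont _ (torus_continuous_kernel xi _ cDf).
set G := kernel xi f in cr ci p ur ui; set D := kernel xi (Dop j f) in cr' ci' p' ur' ui'.
have df := smooth_dirs _ (Cf.2).
have E : (- xi) 0 j = - xi 0 j by rewrite mxE.
have hre : torus_Rint (fun x => 1 * reF D x + - (xi 0 j)%:~R * reF G x) = 0.
  apply: (@torus_Rint_derive _ _ j (imF G)) => //.
  - exact: lattice_im.
  - exact: continuous_lin.
  - by move=> x eta; rewrite (lattice_re _ p') (lattice_re _ p).
  - move=> x; have [d1 d2] := @is_derive_expix R N (- xi) x j.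
    have h1 := is_derive_re j f x df. have h2 := is_derive_im j f x df.
    rewrite {1}/G imFM.
    apply: is_derive_eq (is_derive_lin 1 1 _ _ _ _ _ _
      (is_deriveM d1 h2) (is_deriveM d2 h1)) _.
    rewrite /D /G /Dop E rmorphN /reF /imF /GRing.scale.
    move: (expix (- xi) x) (f x) (partial j f x) => [c s] [a b] [u v] /=.
    ring.
have him : torus_Rint (fun x => -1 * imF D x + (xi 0 j)%:~R * imF G x) = 0.
  apply: (@torus_Rint_derive _ _ j (reF G)) => //.
  - exact: lattice_re.
  - exact: continuous_lin.
  - by move=> x eta; rewrite (lattice_im _ p') (lattice_im _ p).
  - move=> x; have [d1 d2] := @is_derive_expix R N (- xi) x j.
    have h1 := is_derive_re j f x df. have h2 := is_derive_im j f x df.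
    rewrite {1}/G reFM.
    apply: is_derive_eq (is_derive_lin 1 (-1) _ _ _ _ _ _
      (is_deriveM d1 h1) (is_deriveM d2 h2)) _.
    rewrite /D /G /Dop E rmorphN /reF /imF /GRing.scale.
    move: (expix (- xi) x) (f x) (partial j f x) => [c s] [a b] [u v] /=.
    ring.
rewrite /torus_Rint -![foldr _ _ _]/(coord_ints _ _) coord_ints_lin// in hre.
rewrite /torus_Rint -![foldr _ _ _]/(coord_ints _ _) coord_ints_lin// in him.
rewrite /fourier_coef mulrCA; congr (_ * _).
have -> : (xi 0 j)%:~R = ((xi 0 j)%:~R : R)%:C :> C.
  by rewrite (rmorph_int (real_complex R)).
rewrite !torus_intE /coord_intsC -/D -/G /coord_ints; apply/eqP; rewrite eq_complex /=.
move: hre him; rewrite /coord_ints; set p1 := foldr _ _ _ 0; set p2 := foldr _ _ _ 0.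
set q1 := foldr _ _ _ 0; set q2 := foldr _ _ _ 0 => h1 h2.
by apply/andP; split; apply/eqP; lra.
Qed.

Lemma Dop_expix j eta :
  Dop j (expix eta : V -> C) = fun x => (eta 0 j)%:~R * expix eta x.
Proof.
apply/funext => x; rewrite /Dop partial_expix mulrA; congr (_ * _).
rewrite -(rmorph_int (real_complex R)); apply/eqP; rewrite eq_complex /=.
by apply/andP; split; apply/eqP; ring.
Qed.

(** For distinct frequencies, integration by parts in a coordinate j where they
    differ gives xi_j c = eta_j c for the coefficient c. *)
Lemma fourier_coef_expix xi eta :
  fourier_coef (expix eta : V -> C) xi = (xi == eta)%:R.
Proof.
have [->|neq] := eqVneq xi eta.
  rewrite /fourier_coef.
  have -> : kernel eta (expix eta) = fun=> 1.
    by apply/funext => x; rewrite -expixD addNr expix0.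
  rewrite torus_intE /coord_intsC.
  have -> : reF (fun=> (1 : C)) = (fun=> 1 : R) :> (V -> R) by [].
  have -> : imF (fun=> (1 : C)) = (fun=> 0 : R) :> (V -> R) by [].
  rewrite !coord_ints_cst mulr1 mulr0 size_enum_ord /=.
  have p0 : (2 * pi) ^+ N != 0 :> R by rewrite expf_neq0// gt_eqF// twopi_gt0.
  by rewrite -rmorphM mulVf.
have [j xe] : exists j, xi 0 j != eta 0 j.
  apply/existsP; rewrite -negb_forall; apply: contra neq => /forallP H.
  by apply/eqP/rowP => j; exact/eqP.
have := fourier_coef_Dop j (expix eta : V -> C) xi (Cinfty_torus_expix eta).
rewrite Dop_expix fourier_coefZ; last exact: torus_continuous_expix.
move/eqP; rewrite -subr_eq0 -mulrBl mulf_eq0 => /orP[|/eqP//].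
by rewrite subr_eq0 eqr_int eq_sym (negPf xe).
Qed.

(** Induction on the coordinates.  With the frequencies of the other coordinates
    fixed, the integral over those coordinates is a continuous periodic function
    of x_j all of whose Fourier coefficients vanish; it is zero by the result on
    the circle, and the induction hypothesis applies. *)
Lemma coord_intsC_uniqueness s f : uniq s -> torus_continuous f ->
  (forall xi x, coord_intsC s (fun y => expix xi y * f y) x = 0) -> forall x, f x = 0.
Proof.
elim: s f => [|j s IH] f us cf H x.
  have := H 0 x; rewrite /coord_intsC /reF /imF /=.
  by rewrite expix0 mul1r; case: (f x) => a b /= [-> ->].
move: us => /= /andP[js us].
apply: (IH f us cf) => xi {}x.
have cG := torus_continuousM _ _ (torus_continuous_expix xi) cf.
set G := (fun y => _) in cG *.
have [ur ui] := torus_continuous_ucont _ cG.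
have [cr ci pG] := cG.
pose a (t : R) := coord_ints s (reF G) (set_coord x j t).
pose b (t : R) := coord_ints s (imF G) (set_coord x j t).
have key (k : int) :
    circle_int (fun t => cos (k%:~R * t) * a t + - sin (k%:~R * t) * b t) = 0 /\
    circle_int (fun t => cos (k%:~R * t) * b t + sin (k%:~R * t) * a t) = 0.
  pose c := expix (k *: delta_mx 0 j) : V -> C.
  have cE y t : c (set_coord y j t) = cos (k%:~R * t) +i* sin (k%:~R * t).
    rewrite /c /expix (bigD1 j)//= big1 => [|i ij].
      by rewrite set_coordE !mxE !eqxx mulr1 addr0 mulrC.
    by rewrite !mxE (negPf ij) andbF mulr0 mulr0.
  have cs i y t : i \in s -> c (set_coord y i t) = c y.
    move=> si; have ij : j != i by apply: contra js => /eqP ->.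
    rewrite -[in RHS](set_coord_id y j) cE -[X in c X](set_coord_id _ j) cE.
    by rewrite set_coordE (negPf ij).
  have := H (k *: delta_mx 0 j + xi) x.
  have -> : (fun y => expix (k *: delta_mx 0 j + xi) y * f y) = (fun y => c y * G y).
    by apply/funext => y; rewrite expixD mulrA.
  have := coord_intsC_factor s c G (torus_continuous_expix _) cG cs.
  rewrite /coord_intsC => F.
  have {}F y := congr1 (@^~ y) F.
  rewrite !coord_ints_cons => /eqP; rewrite eq_complex /= => /andP[/eqP E1 /eqP E2].
  split; [rewrite -[RHS]E1|rewrite -[RHS]E2]; rewrite /coord_int;
    congr circle_int; apply/funext => t.
    have := congr1 (@complex.Re R) (F (set_coord x j t)); rewrite cE /= => ->.
    by rewrite mulNr.
  have := congr1 (@complex.Im R) (F (set_coord x j t)); rewrite cE /= => ->.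
  by rewrite addrC.
have ca : continuous a by apply: ucont_line; exact: coord_ints_ucont.
have cb : continuous b by apply: ucont_line; exact: coord_ints_ucont.
have pr F (k : int) t : lattice_periodic F ->
    coord_ints s F (set_coord x j (t + 2 * pi * k%:~R)) = coord_ints s F (set_coord x j t).
  move=> pF; rewrite set_coord_shift; apply: coord_ints_shift => // y.
  have -> : (2 * pi * k%:~R) *: e_ j = period (k *: delta_mx 0 j) :> V.
    apply/rowP => i; rewrite periodE !mxE -mulrA; congr (_ * _).
    by rewrite intrM; case: (_ && _).
  exact: pF.
have cZ (v : R) (h : R -> R) : continuous h -> continuous (fun t => v * h t).
  exact: continuous_fctZ.
have csin (k : int) : continuous (fun t : R => sin (k%:~R * t)).
  move=> t; apply: continuous_comp; last exact: continuous_sin.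
  by apply: cvgM; [exact: cvg_cst|exact: cvg_id].
have ccos (k : int) : continuous (fun t : R => cos (k%:~R * t)).
  move=> t; apply: continuous_comp; last exact: continuous_cos.
  by apply: cvgM; [exact: cvg_cst|exact: cvg_id].
have cc (k : int) (h : R -> R) : continuous h ->
    continuous (fun t : R => cos (k%:~R * t) * h t).
  by apply: continuous_fctM; exact: ccos.
have sc (k : int) (h : R -> R) : continuous h ->
    continuous (fun t : R => sin (k%:~R * t) * h t).
  by apply: continuous_fctM; exact: csin.
pose Ic (k : int) (h : R -> R) := circle_int (fun t => cos (k%:~R * t) * h t).
pose Is (k : int) (h : R -> R) := circle_int (fun t => sin (k%:~R * t) * h t).
have key1 (k : int) : Ic k a - Is k b = 0.
  have [<- _] := key k.
  transitivity (circle_int (fun t => cos (k%:~R * t) * a t + -1 * (sin (k%:~R * t) * b t))).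
    by rewrite circle_intD ?circle_intZ ?mulN1r; [|exact: sc|exact: cc|exact/cZ/sc].
  by congr circle_int; apply/funext => t; rewrite mulN1r mulNr.
have key2 (k : int) : Ic k b + Is k a = 0.
  by have [_ <-] := key k; rewrite circle_intD; [|exact: cc|exact: sc].
have Icn (k : int) h : Ic (- k) h = Ic k h.
  by congr circle_int; apply/funext => t; rewrite rmorphN mulNr cosN.
have Isn (k : int) h : continuous h -> Is (- k) h = - Is k h.
  move=> ch; rewrite /Is -[RHS]mulN1r -circle_intZ; last exact: sc.
  by congr circle_int; apply/funext => t; rewrite rmorphN mulNr sinN mulN1r mulNr.
have zero (k : int) : [/\ Ic k a = 0, Is k a = 0, Ic k b = 0 & Is k b = 0].
  have := key1 k; have := key1 (- k); have := key2 k; have := key2 (- k).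
  by rewrite !Icn !Isn// => h1 h2 h3 h4; split; lra.
have [A HA] := periodic_bounded _ cr (lattice_re _ pG).
have [B HB] := periodic_bounded _ ci (lattice_im _ pG).
have a0 : forall t, a t = 0.
  apply: (circle_uniqueness a ((2 * pi) ^+ size s * A)) => //.
  - by move=> t k; apply: pr; exact: lattice_re.
  - by move=> t; exact: coord_ints_bound.
  - move=> k; have [<- _ _ _] := zero k.
    by congr circle_int; apply/funext => t; rewrite mulrC.
  - move=> k; have [_ <- _ _] := zero k.
    by congr circle_int; apply/funext => t; rewrite mulrC.
have b0 : forall t, b t = 0.
  apply: (circle_uniqueness b ((2 * pi) ^+ size s * B)) => //.
  - by move=> t k; apply: pr; exact: lattice_im.
  - by move=> t; exact: coord_ints_bound.
  - move=> k; have [_ _ <- _] := zero k.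
    by congr circle_int; apply/funext => t; rewrite mulrC.
  - move=> k; have [_ _ _ <-] := zero k.
    by congr circle_int; apply/funext => t; rewrite mulrC.
by rewrite /coord_intsC -[x](set_coord_id _ j) -/(a _) -/(b _) a0 b0.
Qed.

(** The full iterated integral depends on no coordinate, so its vanishing at 0 is
    its vanishing everywhere. *)
Lemma fourier_uniqueness f : torus_continuous f ->
  (forall xi, fourier_coef f xi = 0) -> forall x, f x = 0.
Proof.
move=> cf H; apply: (coord_intsC_uniqueness (enum 'I_N)) => //; first exact: enum_uniq.
move=> xi x; have := H (- xi); rewrite /fourier_coef opprK => /eqP.
rewrite mulf_eq0 => /orP[/eqP/(congr1 (@complex.Re _))/= /eqP|/eqP].
  by rewrite invr_eq0 expf_eq0 (gt_eqF (@twopi_gt0 R)) andbF.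
rewrite torus_intE /coord_intsC => E; rewrite -[RHS]E.
by congr (_ +i* _); apply: coord_ints_dep => k; rewrite mem_enum.
Qed.

End FourierCoefficients.

(** * Sums over the integer lattice *)

Section LatticeSums.
Context {R : realType} {N : nat}.
Implicit Types (xi eta : 'rV[int]_N) (j k : 'I_N).

Lemma enorm_ge0 xi : 0 <= enorm xi :> R.
Proof. exact: sqrtr_ge0. Qed.

Lemma coord_le_enorm xi j : `|(xi 0 j)%:~R| <= enorm xi :> R.
Proof.
rewrite -sqrtr_sqr ler_wsqrtr// (bigD1 j)//= lerDl.
by apply: sumr_ge0 => i _; exact: sqr_ge0.
Qed.

Lemma enorm_le_sum xi : enorm xi <= \sum_j `|(xi 0 j)%:~R| :> R.
Proof.
rewrite /enorm; suff [h1 h2] : (0 <= \sum_j `|(xi 0 j)%:~R| :> R) /\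
    \sum_j (xi 0 j)%:~R ^+ 2 <= (\sum_j `|(xi 0 j)%:~R|) ^+ 2 :> R.
  by rewrite -[leRHS]ger0_norm// -sqrtr_sqr ler_wsqrtr.
elim/big_ind2 : _ => [|a b c d [b0 ab] [d0 cd]|i _].
- by rewrite expr0n.
- split; first exact: addr_ge0.
  rewrite (le_trans (lerD ab cd))// sqrrD addrAC lerDl.
  by rewrite mulrn_wge0// mulr_ge0.
- by rewrite real_normK ?num_real.
Qed.

(** Compares |xi| with a single coordinate, since integration by parts only
    produces powers of single coordinates.  The summand 1 is absorbed because a
    nonzero integer has absolute value at least 1. *)
Lemma exists_dominant_coord xi : xi != 0 ->
  exists j, 1 + enorm xi <= N.+1%:R * `|(xi 0 j)%:~R| :> R.
Proof.
move=> xi0; have [i xi0i] : exists i, xi 0 i != 0.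
  apply/existsP; rewrite -negb_forall; apply: contra xi0 => /forallP H.
  by apply/eqP/rowP => i; rewrite mxE; exact/eqP.
pose j := [arg max_(k > i) `|(xi 0 k)%:~R : R|]%O.
exists j; have jP k : `|(xi 0 k)%:~R : R| <= `|(xi 0 j)%:~R|.
  by rewrite /j; case: arg_maxP => // l _; apply.
rewrite -natr1 mulrDl mul1r addrC; apply: lerD.
  apply: (le_trans (enorm_le_sum xi)).
  apply: (@le_trans _ _ (\sum_(k < N) `|(xi 0 j)%:~R : R|)).
    by apply: ler_sum => k _; exact: jP.
  by rewrite sumr_const card_ord mulr_natl.
apply: le_trans (jP i); rewrite -intr_norm -[1]/(1%:~R) ler_int.
by rewrite -gtz0_ge1 normr_gt0.
Qed.

(** A product weight, whose sum over a box factors into sums over one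
    coordinate. *)
Definition lattice_weight xi : R := \prod_(j < N) ((1 + `|(xi 0 j)%:~R|) ^+ 2)^-1.

Lemma lattice_weight_ge xi : ((1 + enorm xi) ^+ (2 * N))^-1 <= lattice_weight xi.
Proof.
have p1 : 0 < 1 + enorm xi :> R by rewrite ltr_pwDl// enorm_ge0.
have p2 : 0 < \prod_(j < N) (1 + `|(xi 0 j)%:~R|) ^+ 2 :> R.
  by apply: prodr_gt0 => j _; rewrite exprn_gt0// ltr_pwDl.
rewrite /lattice_weight prodfV lef_pV2 ?posrE ?exprn_gt0//.
rewrite exprM -[X in _ ^+ X]card_ord -prodr_const.
apply: ler_prod => j _; rewrite exprn_ge0 ?addr_ge0//=.
by rewrite lerXn2r ?nnegrE ?addr_ge0 ?enorm_ge0// lerD2l coord_le_enorm.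
Qed.

(** Telescoping: v(z) = 2 z / (1 + |z|) takes values in [-2, 2], and its
    increment from z to z + 1 dominates 1 / (1 + |z|)^2. *)
Lemma sum_inv_sqr (K : nat) :
  \sum_(i < K.*2.+1) ((1 + `|(i%:Z - K%:Z)%:~R|) ^+ 2)^-1 <= 4 :> R.
Proof.
pose v (i : nat) : R := let z := i%:Z - K%:Z in 2 * z%:~R / (1 + `|z%:~R|).
have vb i : `|v i| <= 2.
  rewrite /v normrM normfV [X in _ / X]ger0_norm ?addr_ge0// normrM ger0_norm//.
  by rewrite ler_pdivrMr ?ltr_pwDl// ler_pM2l// lerDr.
apply: (@le_trans _ _ (\sum_(0 <= i < K.*2.+1) (v i.+1 - v i))).
  rewrite big_mkord; apply: ler_sum => i _.
  rewrite /v; have -> : i.+1%:Z - K%:Z = (i%:Z - K%:Z) + 1 by lia.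
  set z : int := i%:Z - K%:Z; rewrite (intrD R z 1).
  have [z0|z0] := leP 0 z.
    have zr : 0 <= z%:~R :> R by rewrite ler0z.
    rewrite !ger0_norm ?addr_ge0//; set q := z%:~R in zr *.
    have -> : 2 * (q + 1) / (1 + (q + 1)) - 2 * q / (1 + q) = 2 / ((q + 2) * (1 + q)).
      by field; rewrite !gt_eqF//; lra.
    rewrite ler_pdivlMr ?mulr_gt0//; try lra.
    rewrite mulrC ler_pdivrMr ?exprn_gt0//; try lra.
    by nra.
  have zr : z%:~R <= -1 :> R by rewrite -[-1]/((-1)%:~R) ler_int; lia.
  rewrite !ler0_norm; try lra; set q := z%:~R in zr *.
  have -> : 2 * (q + 1) / (1 - (q + 1)) - 2 * q / (1 - q) = 2 / ((- q) * (1 - q)).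
    by field; apply/and3P; split; [rewrite gt_eqF|rewrite lt_eqF|rewrite gt_eqF]; lra.
  rewrite ler_pdivlMr ?mulr_gt0//; try lra.
  rewrite mulrC ler_pdivrMr ?exprn_gt0//; try lra.
  by nra.
rewrite telescope_sumr//.
have := vb K.*2.+1; have := vb 0%N; rewrite !ler_norml => /andP[? ?] /andP[? ?].
by lra.
Qed.

End LatticeSums.

Section LatticeBalls.
Context {R : realType} {N : nat}.
Implicit Types (xi eta : 'rV[int]_N) (j : 'I_N) (k K : nat).

Definition box_point (K : nat) (f : {ffun 'I_N -> 'I_(K.*2.+1)}) : 'rV[int]_N :=
  \row_j ((f j)%:Z - K%:Z).

Definition box K : seq 'rV[int]_N := [seq box_point K f | f : {ffun 'I_N -> 'I_(K.*2.+1)}].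

Lemma box_uniq K : uniq (box K).
Proof.
rewrite map_inj_uniq ?enum_uniq// => f g /rowP fg.
apply/ffunP => j; have := fg j; rewrite !mxE => /addIr [] ?; exact/val_inj.
Qed.

Lemma ball_sub_box K xi : enorm xi <= K%:R :> R -> xi \in box K.
Proof.
move=> xK; have jP j : (`|xi ord0 j| <= K)%N.
  rewrite -(ler_nat R) natr_absz intr_norm.
  exact: le_trans (coord_le_enorm _ _) xK.
have P j : (`|(xi ord0 j + K%:Z)%R| < K.*2.+1)%N by have := jP j; lia.
apply/mapP; exists [ffun j => Ordinal (P j)]; first by rewrite mem_enum.
by apply/rowP => j; rewrite mxE ffunE /= -[xi 0 j]/(xi ord0 j); have := jP j; lia.
Qed.

Definition lattice_ball (k : nat) : seq 'rV[int]_N :=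
  finmap.enum_fset (fset_set [set xi | enorm xi <= k%:R :> R]).

Lemma lattice_ball_finite k : finite_set [set xi : 'rV[int]_N | enorm xi <= k%:R :> R].
Proof.
apply: sub_finite_set (finite_seq (box k)) => xi /=.
exact: ball_sub_box.
Qed.

Lemma lattice_ballE k xi : (xi \in lattice_ball k) = (enorm xi <= k%:R :> R).
Proof.
have E : (xi \in lattice_ball k) = (xi \in [set xi | enorm xi <= k%:R :> R]).
  exact: (in_fset_set (lattice_ball_finite k) xi).
by rewrite E; apply/idP/idP; [move/set_mem|move=> ?; apply/mem_set].
Qed.

Lemma lattice_ball_uniq k : uniq (lattice_ball k).
Proof. exact: finmap.fset_uniq. Qed.

Lemma sum_lattice_weight k : \sum_(xi <- lattice_ball k) lattice_weight xi <= 4 ^+ N :> R.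
Proof.
have w0 xi : 0 <= lattice_weight xi :> R.
  by apply: prodr_ge0 => j _; rewrite invr_ge0 sqr_ge0.
apply: (@le_trans _ _ (\sum_(xi <- box k) lattice_weight xi)).
  have -> : \sum_(xi <- lattice_ball k) lattice_weight xi =
      \sum_(xi <- box k | xi \in lattice_ball k) lattice_weight xi :> R.
    rewrite -[RHS]big_filter; apply: perm_big; apply: uniq_perm.
    - exact: lattice_ball_uniq.
    - by rewrite filter_uniq// box_uniq.
    - move=> xi; rewrite mem_filter; case: (boolP (xi \in _)) => // /[!lattice_ballE].
      by move=> /ball_sub_box ->.
  by rewrite big_mkcond; apply: ler_sum => xi _; case: ifP.
rewrite /box big_image /= /lattice_weight.
rewrite (eq_bigr (fun f : {ffun 'I_N -> 'I_(k.*2.+1)} =>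
   \prod_(j < N) ((1 + `|((f j)%:Z - k%:Z)%:~R|) ^+ 2)^-1)); last first.
  by move=> f _; apply: eq_bigr => j _; rewrite mxE.
rewrite -(bigA_distr_bigA (fun (_ : 'I_N) (i : 'I_(k.*2.+1)) =>
   ((1 + `|(i%:Z - k%:Z)%:~R|) ^+ 2)^-1)) /=.
rewrite -[X in 4 ^+ X]card_ord -prodr_const.
apply: ler_prod => j _; rewrite sum_inv_sqr andbT.
by apply: sumr_ge0 => i _; rewrite invr_ge0 sqr_ge0.
Qed.

(** Outside the ball of radius k one factor 1 + |xi| is at least k + 1; the
    remaining 2N factors are summable. *)
Lemma lattice_tail (c : 'rV[int]_N -> R) (B : R) : 
  (forall xi, 0 <= c xi) ->
  (forall xi, (1 + enorm xi) ^+ (2 * N).+1 * c xi <= B) ->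
  forall k K, \sum_(xi <- lattice_ball K | ~~ (enorm xi <= k%:R :> R)) c xi
    <= B * 4 ^+ N / k.+1%:R.
Proof.
move=> c0 cB k K.
have B0 : 0 <= B.
  by rewrite (le_trans _ (cB 0))// mulr_ge0// exprn_ge0// addr_ge0// enorm_ge0.
have w0 xi : 0 <= lattice_weight xi :> R.
  by apply: prodr_ge0 => j _; rewrite invr_ge0 sqr_ge0.
apply: (@le_trans _ _ (\sum_(xi <- lattice_ball K) B / k.+1%:R * lattice_weight xi)).
  rewrite big_mkcond; apply: ler_sum => xi _; case: ifP => [|_]; last first.
    by rewrite mulr_ge0// divr_ge0.
  rewrite -ltNge => kxi.
  have e0 : 0 < 1 + enorm xi :> R by rewrite ltr_pwDl// enorm_ge0.
  apply: (@le_trans _ _ (B / k.+1%:R * ((1 + enorm xi) ^+ (2 * N))^-1)); last first.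
    by rewrite ler_wpM2l ?lattice_weight_ge// divr_ge0.
  rewrite ler_pdivlMr ?exprn_gt0// ler_pdivlMr ?ltr0n//.
  apply: le_trans (cB xi).
  rewrite exprS mulrC [c xi * _]mulrC mulrA ler_wpM2r// ler_wpM2r ?exprn_ge0 ?ltW//.
  by rewrite -natr1 [_ + 1]addrC ltrD2l.
rewrite -mulr_sumr [leRHS]mulrAC ler_wpM2l//; first by rewrite divr_ge0.
exact: sum_lattice_weight.
Qed.

End LatticeBalls.

(** * Fourier inversion with a rate *)

Section FourierInversion.
Context {R : realType} {N : nat}.
Local Notation V := 'rV[R]_N.
Local Notation C := R[i].
Local Notation normc := Normc.normc.
Implicit Types (f g : V -> C) (x y : V) (xi eta : 'rV[int]_N) (k K : nat) (r : seq 'rV[int]_N).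

(** The limit is built as the supremum of the lower bounds F_k(x) - B / (k + 1),
    all of which lie below all upper bounds F_k(x) + B / (k + 1). *)
Lemma uniform_limit (F : nat -> V -> R) (B : R) :
  (forall k, continuous (F k)) -> (forall k, lattice_periodic (F k)) ->
  (forall k K x, (k <= K)%N -> `|F K x - F k x| <= B / k.+1%:R) ->
  exists G : V -> R, [/\ continuous G, lattice_periodic G &
    forall k x, `|F k x - G x| <= B / k.+1%:R].
Proof.
move=> cF pF FB.
pose S x : set R := [set F k x - B / k.+1%:R | k in [set: nat]].
have B0 k : 0 <= B / k.+1%:R by apply: le_trans (FB k k 0 (leqnn _)).
have below j k x : F j x - B / j.+1%:R <= F k x + B / k.+1%:R.
  have := B0 j; have := B0 k; have [jk|kj] := leqP j k.
    have := FB j k x jk; move: (B / _) (B / _) => a b.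
    by rewrite ler_norml => /andP[? ?] ? ?; lra.
  have := FB k j x (ltnW kj); move: (B / k.+1%:R) (B / j.+1%:R) => a b.
  by rewrite ler_norml => /andP[? ?] ? ?; lra.
have S0 x : S x !=set0 by exists (F 0%N x - B / 1%:R); exists 0%N.
have uS x k : ubound (S x) (F k x + B / k.+1%:R) by move=> _ [j _ <-]; exact: below.
have FG k x : `|F k x - sup (S x)| <= B / k.+1%:R.
  have h1 : sup (S x) <= F k x + B / k.+1%:R by apply: ge_sup.
  have h2 : F k x - B / k.+1%:R <= sup (S x).
    by apply: ub_le_sup; [exists (F 0%N x + B / 1%:R); exact: uS|exists k].
  by move: (B / k.+1%:R) h1 h2 => a h1 h2; rewrite ler_norml; apply/andP; split; lra.
have pG : lattice_periodic (fun x => sup (S x)).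
  move=> x xi; congr sup; rewrite /S.
  by apply/seteqP; split=> _ [k _ <-]; exists k => //; rewrite pF.
suff cG : continuous (fun x => sup (S x)) by exists (fun x => sup (S x)).
move=> x; apply/(@cvgrPdist_le _ _ _ _ (nbhs_filter x)) => e e0.
have e3 : 0 < e / 3 by rewrite divr_gt0.
pose k := Num.truncn (B / (e / 3)).
have Be : B / k.+1%:R <= e / 3.
  rewrite ler_pdivrMr ?ltr0n// mulrC -ler_pdivrMr//.
  have Bp : 0 <= B by have := B0 0%N; rewrite divr1.
  by have := truncn_itv (divr_ge0 Bp (ltW e3)) => /andP[_ /ltW].
have /cvgrPdist_le/(_ _ e3) := cF k x.
apply: filterS => y xy.
have := FG k x; have := FG k y; move: xy Be; rewrite !ler_norml.
move: (B / k.+1%:R) => a.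
by move=> /andP[? ?] ? /andP[? ?] /andP[? ?]; apply/andP; split; lra.
Qed.

Lemma normcD (z w : C) : normc (z + w) <= normc z + normc w.
Proof. exact: (@le_normcD R z w). Qed.

Lemma normc_sum (I : Type) (r : seq I) (P : pred I) (c : I -> C) :
  normc (\sum_(i <- r | P i) c i) <= \sum_(i <- r | P i) normc (c i).
Proof.
elim/big_ind2 : _ => [|a b c' d ab cd|//]; first by rewrite Normc.normc0.
exact: le_trans (normcD _ _) (lerD ab cd).
Qed.

Definition trigpoly (c : 'rV[int]_N -> C) r : V -> C :=
  fun x => \sum_(xi <- r) c xi * expix xi x.

Lemma trigpoly_cons c xi r :
  trigpoly c (xi :: r) = fun x => (c xi * expix xi x) + trigpoly c r x.
Proof. by apply/funext => x; rewrite /trigpoly big_cons. Qed.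

Lemma trigpoly_nil c : trigpoly c [::] = fun x => 0 * expix 0 x.
Proof. by apply/funext => x; rewrite /trigpoly big_nil mul0r. Qed.

Lemma Cinfty_trigpoly c r : Cinfty_torus (trigpoly c r).
Proof.
elim: r => [|xi r IH].
  by rewrite trigpoly_nil; apply: Cinfty_torusZ; exact: Cinfty_torus_expix.
rewrite trigpoly_cons; apply: Cinfty_torusD; last exact: IH.
by apply: Cinfty_torusZ; exact: Cinfty_torus_expix.
Qed.

Lemma fourier_coef_trigpoly c r xi : uniq r ->
  fourier_coef (trigpoly c r) xi = if xi \in r then c xi else 0.
Proof.
have te eta := @torus_continuous_expix R N eta.
elim: r => [_|eta r IH /= /andP[er ur]].
  by rewrite trigpoly_nil fourier_coefZ// mul0r.
rewrite trigpoly_cons fourier_coefD; last 2 first.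
- exact: torus_continuousZ.
- exact/Cinfty_torus_continuous/Cinfty_trigpoly.
rewrite fourier_coefZ// fourier_coef_expix IH// in_cons.
have [->|_] /= := eqVneq xi eta; last by rewrite mulr0 add0r.
by rewrite (negPf er) mulr1 addr0.
Qed.

Lemma fourier_psumE f k : fourier_psum f k = trigpoly (fourier_coef f) (@lattice_ball R N k).
Proof.
apply/funext => x; rewrite /fourier_psum /trigpoly /lattice_ball fsbig_finite//.
exact: lattice_ball_finite.
Qed.

Lemma fourier_psum_split f k K x : (k <= K)%N ->
  fourier_psum f K x - fourier_psum f k x =
  \sum_(xi <- @lattice_ball R N K | ~~ (enorm xi <= k%:R :> R)) fourier_coef f xi * expix xi x.
Proof.
move=> kK; rewrite !fourier_psumE /trigpoly.
rewrite (bigID (fun xi => enorm xi <= k%:R :> R))/=.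
suff -> : \sum_(xi <- @lattice_ball R N K | enorm xi <= k%:R :> R)
     fourier_coef f xi * expix xi x =
   \sum_(xi <- @lattice_ball R N k) fourier_coef f xi * expix xi x.
  by rewrite addrAC subrr add0r.
rewrite -big_filter; apply: perm_big; apply: uniq_perm.
- by rewrite filter_uniq// lattice_ball_uniq.
- exact: lattice_ball_uniq.
- move=> xi; rewrite mem_filter !lattice_ballE; case: leP => //= xk.
  by rewrite (le_trans xk)// ler_nat.
Qed.

(** The partial sums converge uniformly to some continuous g, with the stated
    rate by the tail estimate.  The coefficient of g at xi is the limit of those
    of the partial sums, which are equal to that of f as soon as k >= |xi|; so g
    and f have the same coefficients and are equal. *)
Lemma fourier_psum_rate f (B : R) : torus_continuous f ->
  (forall xi, (1 + enorm xi) ^+ (2 * N).+1 * normc (fourier_coef f xi) <= B) ->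
  forall k x, normc (fourier_psum f k x - f x) <= 2 * (B * 4 ^+ N) / k.+1%:R.
Proof.
move=> cf fB.
have cS k : torus_continuous (fourier_psum f k).
  by rewrite fourier_psumE; exact/Cinfty_torus_continuous/Cinfty_trigpoly.
have tail k K x : (k <= K)%N ->
    normc (fourier_psum f K x - fourier_psum f k x) <= B * 4 ^+ N / k.+1%:R.
  move=> kK; rewrite fourier_psum_split// (le_trans (normc_sum _ _ _ _))//.
  apply: le_trans (lattice_tail (fun xi => normc (fourier_coef f xi)) B _ fB k K).
    by apply: ler_sum => xi _; rewrite Normc.normcM normc_expix mulr1.
  by move=> xi; case: (fourier_coef f xi) => a b /=; exact: sqrtr_ge0.
have hr k K x : (k <= K)%N ->
    `|reF (fourier_psum f K) x - reF (fourier_psum f k) x| <= B * 4 ^+ N / k.+1%:R.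
  by move=> kK; rewrite /reF -raddfB (le_trans (Re_le_normc _))// tail.
have hi k K x : (k <= K)%N ->
    `|imF (fourier_psum f K) x - imF (fourier_psum f k) x| <= B * 4 ^+ N / k.+1%:R.
  by move=> kK; rewrite /imF -raddfB (le_trans (Im_le_normc _))// tail.
have cr k : continuous (reF (fourier_psum f k)) by case: (cS k).
have ci k : continuous (imF (fourier_psum f k)) by case: (cS k).
have per k : lattice_periodic (reF (fourier_psum f k)).
  by apply: lattice_re; case: (cS k).
have pei k : lattice_periodic (imF (fourier_psum f k)).
  by apply: lattice_im; case: (cS k).
have [Gr [cGr pGr Grk]] := uniform_limit _ _ cr per hr.
have [Gi [cGi pGi Gik]] := uniform_limit _ _ ci pei hi.
pose g x : C := Gr x +i* Gi x.
have cg : torus_continuous g.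
  by split=> // x xi; rewrite /g pGr pGi.
have rate k x : normc (fourier_psum f k x - g x) <= 2 * (B * 4 ^+ N) / k.+1%:R.
  apply: (le_trans (normc_le_ReIm _)); rewrite !raddfB -mulrA mulr_natl mulr2n.
  by apply: lerD; [exact: Grk|exact: Gik].
suff fg x : f x = g x by move=> k x; rewrite fg.
have cN (h : V -> C) : torus_continuous h -> torus_continuous (fun x => -1 * h x).
  exact: torus_continuousZ.
apply/eqP; rewrite -subr_eq0 -mulN1r; apply/eqP; move: x.
apply: (fourier_uniqueness (fun x => f x + -1 * g x)).
  by apply: torus_continuousD => //; exact: cN.
move=> xi; rewrite fourier_coefD ?fourier_coefZ//; last exact: cN.
apply: Normc.eq0_normc; apply/eqP; rewrite eq_le; apply/andP; split; last first.
  by case: (_ + _) => a b /=; exact: sqrtr_ge0.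
apply/ler_addgt0Pr => e e0; rewrite add0r.
pose D := 2 * (2 * (B * 4 ^+ N)).
(* k is past |xi|, so the k-th partial sum already has the coefficient of f at
   xi, and it is large enough to bring the error D / (k + 1) below e. *)
pose k := maxn (Num.truncn (enorm xi : R)).+1 (Num.truncn (D / e)).
have xk : xi \in @lattice_ball R N k.
  rewrite lattice_ballE ltW//; have /andP[_ h] := truncn_itv (@enorm_ge0 R N xi).
  by apply: (lt_le_trans h); rewrite ler_nat leq_maxl.
have -> : fourier_coef f xi + -1 * fourier_coef g xi =
   fourier_coef (fun x => fourier_psum f k x + -1 * g x) xi.
  rewrite fourier_coefD//; last exact: cN.
  rewrite fourier_coefZ// fourier_psumE fourier_coef_trigpoly ?lattice_ball_uniq//.
  by rewrite xk.
apply: (@le_trans _ _ (2 * (2 * (B * 4 ^+ N) / k.+1%:R))).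
  apply: fourier_coef_bound; first by apply: torus_continuousD => //; exact: cN.
  by move=> x; rewrite mulN1r; exact: rate.
rewrite mulrA -/D ler_pdivrMr ?ltr0n// mulrC -ler_pdivrMr//.
have [D0|D0] := leP 0 (D / e); last by rewrite (le_trans (ltW D0)).
have /andP[_ h] := truncn_itv D0; apply/ltW/(lt_le_trans h).
by rewrite ler_nat ltnS leq_maxr.
Qed.

End FourierInversion.

(** * Higher derivatives of Fourier series *)

Section MultiDerivatives.
Context {R : realType} {N : nat}.
Local Notation V := 'rV[R]_N.
Local Notation C := R[i].
Local Notation normc := Normc.normc.
Implicit Types (f g : V -> C) (x y : V) (xi eta : 'rV[int]_N) (j : 'I_N) (s : seq 'I_N)
  (alpha : 'rV[nat]_N) (k K n : nat) (r : seq 'rV[int]_N).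

(** [Dmulti] with the list of coordinates as a parameter, for induction. *)
Definition Dpart alpha s f : V -> C :=
  foldr (fun j g => iter (alpha ord0 j) (Dop j) g) f s.

Lemma Dpart_cons alpha j s f :
  Dpart alpha (j :: s) f = iter (alpha ord0 j) (Dop j) (Dpart alpha s f).
Proof. by []. Qed.

Lemma DmultiE alpha f : Dmulti alpha f = Dpart alpha (enum 'I_N) f.
Proof. by []. Qed.

Lemma Cinfty_torus_iter n j f : Cinfty_torus f -> Cinfty_torus (iter n (Dop j) f).
Proof.
by move=> Cf; elim: n => [|n IH]; [exact: Cf|exact: Cinfty_torus_Dop].
Qed.

Lemma Cinfty_torus_Dpart alpha s f : Cinfty_torus f -> Cinfty_torus (Dpart alpha s f).
Proof.
by move=> Cf; elim: s => [|j s IH]; [exact: Cf|exact: Cinfty_torus_iter].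
Qed.

Lemma DopZ j (a : C) f : Cinfty_torus f ->
  Dop j (fun x => a * f x) = fun x => a * Dop j f x.
Proof.
move=> [_ sf]; apply/funext => x; rewrite /Dop partialZ; last exact: smooth_dirs.
by rewrite mulrCA.
Qed.

Lemma DopD j f g : Cinfty_torus f -> Cinfty_torus g ->
  Dop j (fun x => f x + g x) = fun x => Dop j f x + Dop j g x.
Proof.
move=> [_ sf] [_ sg]; apply/funext => x; rewrite /Dop partialD; try exact: smooth_dirs.
by rewrite mulrDr.
Qed.

Lemma DpartZ alpha s (a : C) f : Cinfty_torus f ->
  Dpart alpha s (fun x => a * f x) = fun x => a * Dpart alpha s f x.
Proof.
move=> Cf; elim: s => [//|j s IH]; rewrite !Dpart_cons IH.
elim: (alpha ord0 j) => //= n ->; apply: DopZ.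
exact/Cinfty_torus_iter/Cinfty_torus_Dpart.
Qed.

Lemma DpartD alpha s f g : Cinfty_torus f -> Cinfty_torus g ->
  Dpart alpha s (fun x => f x + g x) = fun x => Dpart alpha s f x + Dpart alpha s g x.
Proof.
move=> Cf Cg; elim: s => [//|j s IH]; rewrite !Dpart_cons IH.
elim: (alpha ord0 j) => //= n ->.
by apply: DopD; exact/Cinfty_torus_iter/Cinfty_torus_Dpart.
Qed.

Definition monomial alpha s xi : C := \prod_(j <- s) (xi 0 j)%:~R ^+ alpha ord0 j.

Lemma monomial_cons alpha j s xi :
  monomial alpha (j :: s) xi = (xi 0 j)%:~R ^+ alpha ord0 j * monomial alpha s xi.
Proof. by rewrite /monomial big_cons. Qed.

Lemma fourier_coef_iter n j f xi : Cinfty_torus f ->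
  fourier_coef (iter n (Dop j) f) xi = (xi 0 j)%:~R ^+ n * fourier_coef f xi.
Proof.
move=> Cf; elim: n => [|n IH] /=; first by rewrite mul1r.
rewrite fourier_coef_Dop; last exact: Cinfty_torus_iter.
by rewrite IH exprS mulrA.
Qed.

Lemma fourier_coef_Dpart alpha s f xi : Cinfty_torus f ->
  fourier_coef (Dpart alpha s f) xi = monomial alpha s xi * fourier_coef f xi.
Proof.
move=> Cf; elim: s => [|j s IH]; first by rewrite /monomial big_nil mul1r.
rewrite Dpart_cons fourier_coef_iter; last exact: Cinfty_torus_Dpart.
by rewrite IH monomial_cons mulrA.
Qed.

Lemma Dpart_expix alpha s xi :
  Dpart alpha s (expix xi : V -> C) = fun x => monomial alpha s xi * expix xi x.
Proof.
have Ce := @Cinfty_torus_expix R N xi.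
elim: s => [|j s IH].
  by apply/funext => x; rewrite /monomial big_nil mul1r.
rewrite Dpart_cons IH monomial_cons; elim: (alpha ord0 j) => [|n /= ->].
  by apply/funext => x; rewrite mul1r.
by rewrite DopZ// Dop_expix; apply/funext => x; rewrite exprS; ring.
Qed.

Lemma Dpart_trigpoly alpha s c r : Dpart alpha s (@trigpoly R N c r) =
  trigpoly (fun xi => monomial alpha s xi * c xi) r.
Proof.
elim: r => [|xi r IH].
  rewrite !trigpoly_nil DpartZ ?Dpart_expix; last exact: Cinfty_torus_expix.
  by apply/funext => x; rewrite !mul0r.
rewrite !trigpoly_cons DpartD; last 2 first.
- by apply: Cinfty_torusZ; exact: Cinfty_torus_expix.
- exact: Cinfty_trigpoly.
rewrite IH DpartZ ?Dpart_expix; last exact: Cinfty_torus_expix.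
by apply/funext => x; congr (_ + _); ring.
Qed.

(** Allows the inversion theorem to be applied to each derivative separately. *)
Lemma Dmulti_psum alpha f k : Cinfty_torus f ->
  Dmulti alpha (fourier_psum f k) = fourier_psum (Dmulti alpha f) k.
Proof.
move=> Cf; rewrite !DmultiE !fourier_psumE Dpart_trigpoly.
by congr trigpoly; apply/funext => xi; rewrite fourier_coef_Dpart.
Qed.

Lemma normcX (z : C) n : normc (z ^+ n) = normc z ^+ n.
Proof.
by elim: n => [|n IH]; [rewrite Normc.normc1|rewrite !exprS Normc.normcM IH].
Qed.

Lemma normc_int (z : int) : normc (z%:~R : C) = `|z%:~R|.
Proof.
by rewrite -(rmorph_int (real_complex R)) /= expr0n addr0 sqrtr_sqr.
Qed.

Lemma normc_monomial alpha xi :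
  normc (monomial alpha (enum 'I_N) xi) <= enorm xi ^+ mlength alpha.
Proof.
rewrite /mlength -(big_enum _ _ (fun=> true)) /monomial.
elim: (enum _) => [|j s IH]; first by rewrite !big_nil Normc.normc1.
rewrite !big_cons Normc.normcM exprD normcX normc_int.
apply: ler_pM => //.
  by case: (\prod_(_ <- _) _) => a b /=; exact: sqrtr_ge0.
by rewrite lerXn2r ?nnegrE ?enorm_ge0// coord_le_enorm.
Qed.

Definition mono_index j n : 'rV[nat]_N := \row_i (if i == j then n else 0%N).

Lemma mlength_mono j n : mlength (mono_index j n) = n.
Proof.
rewrite /mlength (bigD1 j)//= big1 ?mxE ?eqxx ?addn0// => i ij.
by rewrite mxE (negPf ij).
Qed.

Lemma Dmulti_mono j n f : Dmulti (mono_index j n) f = iter n (Dop j) f.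
Proof.
rewrite DmultiE.
have D0 s : j \notin s -> Dpart (mono_index j n) s f = f.
  elim: s => [//|i s IH]; rewrite in_cons negb_or => /andP[ji js].
  by rewrite Dpart_cons IH// mxE eq_sym (negPf ji).
have : j \in enum 'I_N by rewrite mem_enum.
elim: (enum _) (enum_uniq 'I_N) => [//|i s IH] /andP[si us].
rewrite in_cons Dpart_cons; have [ji|ji] /= := eqVneq j i.
  by rewrite -ji mxE eqxx D0 ?ji.
by move=> js; rewrite IH// mxE eq_sym (negPf ji).
Qed.

Lemma Dmulti0 f : Dmulti 0 f = f.
Proof.
rewrite DmultiE; elim: (enum _) => [//|j s IH].
by rewrite Dpart_cons IH mxE.
Qed.

Lemma mlength0 : mlength (0 : 'rV[nat]_N) = 0%N.
Proof. by rewrite /mlength big1// => j _; rewrite mxE. Qed.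

End MultiDerivatives.

(** * Weight sequences and factorials *)

Section WeightSequences.
Context {R : realType}.
Implicit Type m : nat -> R.

(** Logarithmic convexity propagates m_0 <= m_1 to all consecutive terms. *)
Lemma weight_ge1 m n : weight_sequence m -> 1 <= m n.
Proof.
move=> [m0 [m00 m01] mc _].
have mon i : m i <= m i.+1.
  elim: i => [|i IH]; first by rewrite m00 m01.
  rewrite -(ler_pM2l (m0 i.+1)) -expr2 (le_trans (mc i.+1 isT))//= ler_wpM2r// ltW//.
by elim: n => [|n IH]; [rewrite m00|exact: le_trans (mon n)].
Qed.

Lemma bin_le_exp2 n k : ('C(n, k) <= 2 ^ n)%N.
Proof.
elim: n k => [|n IH] [|k] //; first by rewrite bin0 expn_gt0.
by rewrite binS expnS mul2n -addnn leq_add.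
Qed.

Lemma fact_add_le (p a : nat) : ((p + a)`! <= 2 ^ (p + a) * (p`! * a`!))%N.
Proof.
have := bin_fact (leq_addr a p); rewrite addKn => <-.
by rewrite leq_mul2r bin_le_exp2 orbT.
Qed.

End WeightSequences.

(** * Fourier series of ultradifferentiable functions *)

Section UltradifferentiableSeries.
Context {R : realType} {N : nat}.
Local Notation V := 'rV[R]_N.
Local Notation C := R[i].
Local Notation normc := Normc.normc.
Implicit Types (f g phi : V -> C) (x y : V) (xi : 'rV[int]_N) (j : 'I_N)
  (alpha : 'rV[nat]_N) (k n : nat) (m : nat -> R).

Lemma normc_ge0 (z : C) : 0 <= normc z.
Proof. by case: z => a b /=; exact: sqrtr_ge0. Qed.

(** The bound on [f] itself serves for the zero frequency, where no coordinate
    dominates. *)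
Lemma fourier_coef_decay f (B : R) n : Cinfty_torus f ->
  (forall x, normc (f x) <= B) ->
  (forall j x, normc (iter n (Dop j) f x) <= B) ->
  forall xi, (1 + enorm xi) ^+ n * normc (fourier_coef f xi) <= 2 * N.+1%:R ^+ n * B.
Proof.
move=> Cf fB DB xi.
have cf := Cinfty_torus_continuous _ Cf.
have B0 : 0 <= B by exact: le_trans (normc_ge0 _) (fB 0).
have [->|xi0] := eqVneq xi 0.
  have -> : enorm (0 : 'rV[int]_N) = 0 :> R.
    by rewrite /enorm big1 ?sqrtr0// => j _; rewrite mxE expr0n.
  rewrite addr0 expr1n mul1r (le_trans (fourier_coef_bound _ _ _ cf fB))//.
  by rewrite mulrAC ler_peMr ?mulr_ge0// exprn_ege1// ler1n.
have [j xij] := @exists_dominant_coord R N xi xi0.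
have e0 : 0 <= 1 + enorm xi :> R by rewrite addr_ge0// enorm_ge0.
apply: (@le_trans _ _ ((N.+1%:R * `|(xi 0 j)%:~R|) ^+ n * normc (fourier_coef f xi))).
  by rewrite ler_wpM2r ?normc_ge0// lerXn2r ?nnegrE ?mulr_ge0.
rewrite exprMn -[leLHS]mulrA -normc_int -normcX -Normc.normcM -fourier_coef_iter//.
rewrite [2 * _]mulrC -[leRHS]mulrA ler_wpM2l ?exprn_ge0//.
apply: fourier_coef_bound (DB j).
exact/Cinfty_torus_continuous/Cinfty_torus_iter.
Qed.

(** The frequency 0 requires A >= 1, whence h + 1 in place of h. *)
Lemma E_M_coef_decay m phi : weight_sequence m -> E_M m phi ->
  exists C A : R, [/\ 0 < C, 1 <= A & forall n xi,
    (1 + enorm xi) ^+ n * normc (fourier_coef phi xi) <= C * A ^+ n * m n * n`!%:R].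
Proof.
move=> hm [Cphi [C [h [C0 h0 hC]]]].
have [m0 [m00 _] _ _] := hm.
have m1 n := weight_ge1 m n hm.
have h1 : 1 <= h + 1 by rewrite lerDr ltW.
exists (2 * C), (N.+1%:R * (h + 1)); split.
- by rewrite mulr_gt0.
- by rewrite mulr_ege1// ler1n.
move=> n xi; have Bn : C * h ^+ n * m n * n`!%:R <= C * (h + 1) ^+ n * m n * n`!%:R.
  rewrite !ler_wpM2r ?ler0n// ?(ltW (m0 n))// ler_wpM2l ?(ltW C0)//.
  by rewrite lerXn2r ?nnegrE ?(ltW h0) ?addr_ge0 ?(ltW h0)// lerDl.
have := @fourier_coef_decay phi (C * (h + 1) ^+ n * m n * n`!%:R) n Cphi.
move=> /(_ _ _ xi) H; apply: (le_trans (H _ _)).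
- move=> x; have := hC x 0; rewrite Dmulti0 mlength0 m00 expr0 !mulr1 => /le_trans; apply.
  rewrite -!mulrA ler_peMr ?(ltW C0)// mulr_ege1 ?exprn_ege1// mulr_ege1//.
  by rewrite ler1n fact_gt0.
- move=> j x; have := hC x (mono_index j n); rewrite Dmulti_mono mlength_mono.
  by move=> /le_trans; apply.
by rewrite le_eqVlt exprMn; apply/orP; left; apply/eqP; ring.
Qed.

(** The geometric factor [T] and the constant do not depend on alpha: the order
    2N + 1 spent on summability is split off m_n and n! at a geometric cost. *)
Lemma E_M_psum_rate m phi : weight_sequence m -> E_M m phi ->
  exists C T : R, [/\ 0 < C, 0 < T & forall k alpha x,
    normc (Dmulti alpha (fourier_psum phi k) x - Dmulti alpha phi x)
      <= C * T ^+ mlength alpha * m (mlength alpha) * (mlength alpha)`!%:R / k.+1%:R].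
Proof.
move=> hm hphi; have [C [A [C0 A1 hC]]] := E_M_coef_decay m phi hm hphi.
have Cphi := hphi.1.
have [m0 _ _ [H H1 mH]] := hm.
have A0 : 0 < A by exact: lt_le_trans A1.
have H0 : 0 < H by exact: lt_trans H1.
pose p := (2 * N).+1; pose T := 2 * A * H.
have T0 : 0 < T by rewrite !mulr_gt0.
exists (2 * 4 ^+ N * (C * T ^+ p * m p * p`!%:R)), T; split=> //.
  by rewrite !mulr_gt0 ?exprn_gt0// ltr0n fact_gt0.
move=> k alpha x; set a := mlength alpha.
rewrite Dmulti_psum//.
have CD : Cinfty_torus (Dmulti alpha phi) by rewrite DmultiE; exact: Cinfty_torus_Dpart.
have := @fourier_psum_rate R N (Dmulti alpha phi)
  (C * T ^+ p * m p * p`!%:R * (T ^+ a * m a * a`!%:R))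
  (Cinfty_torus_continuous _ CD).
move=> /(_ _ k x) K; apply: le_trans (K _) _; last first.
  by rewrite le_eqVlt; apply/orP; left; apply/eqP; ring.
move=> xi; have e0 : 0 <= 1 + enorm xi :> R by rewrite addr_ge0// enorm_ge0.
rewrite DmultiE fourier_coef_Dpart// Normc.normcM.
apply: (@le_trans _ _ ((1 + enorm xi) ^+ (p + a) * normc (fourier_coef phi xi))).
  rewrite mulrA exprD ler_wpM2r ?normc_ge0// ler_wpM2l ?exprn_ge0//.
  rewrite (le_trans (normc_monomial _ _))// lerXn2r ?nnegrE ?enorm_ge0//.
  by rewrite lerDr.
apply: (le_trans (hC _ _)).
have F : (p + a)`!%:R <= 2 ^+ (p + a) * (p`!%:R * a`!%:R) :> R.
  by rewrite -natrX -!natrM ler_nat fact_add_le.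
apply: (@le_trans _ _ (C * A ^+ (p + a) * (H ^+ (p + a) * m p * m a) *
    (2 ^+ (p + a) * (p`!%:R * a`!%:R)))).
  have CA : 0 <= C * A ^+ (p + a) by rewrite mulr_ge0 ?exprn_ge0 ?ltW.
  apply: ler_pM => //; first by rewrite mulr_ge0// ltW.
  by rewrite ler_wpM2l.
by rewrite le_eqVlt /T !exprMn !exprD; apply/orP; left; apply/eqP; ring.
Qed.

(** Membership of the partial sums in [E_M] follows from their distance to phi,
    without any direct estimate of trigonometric polynomials. *)
Lemma E_MD m f g : weight_sequence m -> E_M m f -> Cinfty_torus g ->
  (exists C h : R, [/\ 0 < C, 0 < h & forall x alpha,
    normc (Dmulti alpha g x - Dmulti alpha f x)
      <= C * h ^+ mlength alpha * m (mlength alpha) * (mlength alpha)`!%:R]) ->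
  E_M m g.
Proof.
move=> hm [Cf [C [h [C0 h0 hC]]]] Cg [C' [h' [C'0 h'0 hC']]]; split=> //.
have [m0 _ _ _] := hm.
exists (C + C'), (h + h'); split; [exact: addr_gt0|exact: addr_gt0|move=> x alpha].
set a := mlength alpha.
have mono (u v w : R) : 0 < u -> 0 < v -> v <= w ->
    u * v ^+ a * m a * a`!%:R <= u * w ^+ a * m a * a`!%:R.
  move=> u0 v0 vw; rewrite !ler_wpM2r ?ler0n ?(ltW (m0 a))// ler_wpM2l ?(ltW u0)//.
  by rewrite lerXn2r ?nnegrE ?(ltW v0)// (le_trans (ltW v0)).
rewrite -[Dmulti alpha g x](subrK (Dmulti alpha f x)).
apply: (le_trans (normcD _ _)); rewrite !mulrDl addrC; apply: lerD.
  apply: le_trans (hC x alpha) _; apply: mono => //; by rewrite lerDl ltW.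
apply: le_trans (hC' x alpha) _; apply: mono => //; by rewrite lerDr ltW.
Qed.

End UltradifferentiableSeries.
Theorem theorem4p4 (R : realType) (m : nat -> R) (N : nat)
    (hm : weight_sequence m) (hN : (0 < N)%N)
    (phi : 'rV[R]_N -> R[i]) (hphi : E_M m phi) :
  [/\ forall x : 'rV[R]_N,
        (fun k : nat => fourier_psum phi k x : R[i]^o) @ \oo --> (phi x : R[i]^o),
      forall h : nat -> R,
        (forall n, 0 < h n) -> (forall i j, (i < j)%N -> h i < h j) ->
        h @ \oo --> +oo ->
        indlim_cvg m h (fourier_psum phi) phi
    & exists C delta : R, [/\ 0 < C, 0 < delta &
        forall xi : 'rV[int]_N,
          Normc.normc (fourier_coef phi xi) <=
            C * inf [set r : R | exists n : nat,
                  r = m n * n`!%:R / (delta ^+ n * (1 + enorm xi) ^+ n)]]].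
Proof.
have Cphi := hphi.1.
have [C [T [C0 T0 rate]]] := E_M_psum_rate m phi hm hphi.
have [m0 [m00 _] _ _] := hm.
have rate0 k x : Normc.normc (fourier_psum phi k x - phi x) <= C / k.+1%:R.
  have := rate k 0 x.
  by rewrite !Dmulti0 mlength0 m00 expr0 !mulr1.
have Cpsum k : Cinfty_torus (fourier_psum phi k).
  by rewrite fourier_psumE; exact: Cinfty_trigpoly.
have smallness (e : R) : 0 < e -> \forall k \near \oo, C / k.+1%:R < e.
  move=> e0; near=> k.
  rewrite ltr_pdivrMr ?ltr0n// mulrC -ltr_pdivrMr//.
  have /andP[_ h] := truncn_itv (divr_ge0 (ltW C0) (ltW e0)).
  apply: (lt_le_trans h); rewrite ler_nat ltnS.
  by near: k; exact: nbhs_infty_ge.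
split.
- move=> x; apply/cvgrPdist_lt => e e0.
  have [er er0 eE] : exists2 er : R, 0 < er & e = er%:C.
    move: e0; case: e => a b; rewrite ltcE /= => /andP[/eqP -> a0].
    by exists a.
  apply: filterS (smallness er er0) => k ck.
  rewrite distrC eE -[X in X < _]/((Normc.normc (fourier_psum phi k x - phi x))%:C).
  by rewrite ltcR (le_lt_trans (rate0 k x)).
- move=> h h0 hinc hoo.
  have EMp k : E_M m (fourier_psum phi k).
    apply: E_MD hm hphi (Cpsum k) _; exists C, T; split=> // x alpha.
    apply: le_trans (rate k alpha x) _.
    rewrite ler_pdivrMr ?ltr0n// ler_peMr ?ler1n//.
    by rewrite !mulr_ge0 ?exprn_ge0 ?ltW// ler0n.
  split=> // G [GE Gopen] Gphi.
  have [U [UE Uac Un] UG] := Gopen phi Gphi.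
  have [n Tn] : exists n, T <= h n.
    have /cvgryPge/(_ T) := hoo.
    by move=> /filter_ex[n Tn]; exists n.
  have [r r0 Ur] := Un n.
  have r2 : 0 < r / 2 by rewrite divr_gt0.
  near=> k.
  have kr : C / k.+1%:R < r / 2 by near: k; exact: smallness.
  pose g x := fourier_psum phi k x + -1 * phi x.
  have -> : fourier_psum phi k = (fun x => phi x + g x).
    by apply/funext => x; rewrite /g mulN1r addrC subrK.
  have Cg : Cinfty_torus g 
    by apply: Cinfty_torusD; [exact: Cpsum|exact: Cinfty_torusZ].
  have Dg alpha x : Dmulti alpha g x =
      Dmulti alpha (fourier_psum phi k) x - Dmulti alpha phi x.
    rewrite !DmultiE DpartD; [|exact: Cpsum|exact: Cinfty_torusZ].
    by rewrite DpartZ; [rewrite mulN1r|exact: Cphi].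
  have ng : (norm_Mh m (h n) g <= (r / 2)%:E)%E.
    apply: ge_ereal_sup => _ [x [alpha ->]]; rewrite lee_fin Dg.
    set a := mlength alpha.
    have w0 : 0 < h n ^+ a * m a * a`!%:R.
      by rewrite !mulr_gt0 ?exprn_gt0// ltr0n fact_gt0.
    rewrite ler_pdivrMr//; apply: le_trans (rate k alpha x) _.
    apply: (@le_trans _ _ (C / k.+1%:R * (h n ^+ a * m a * a`!%:R))).
      have -> : C * T ^+ a * m a * a`!%:R / k.+1%:R = C / k.+1%:R * (T ^+ a * m a * a`!%:R).
        by ring.
      rewrite ler_wpM2l ?divr_ge0 ?(ltW C0)// !ler_wpM2r ?ler0n ?(ltW (m0 a))//.
      by rewrite lerXn2r ?nnegrE ?(ltW T0) ?(ltW (h0 n)).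
    by rewrite ler_wpM2r ?(ltW w0)// ltW.
  have ngr : (norm_Mh m (h n) g < r%:E)%E.
    apply: le_lt_trans ng _; rewrite lte_fin ltr_pdivrMr// ltr_pMr//.
    by rewrite (ltr_nat R 1 2).
  by apply: UG; apply: Ur => //; split=> //; apply: lt_trans ngr _; rewrite ltry.
- have [D [A [D0 A1 decay]]] := E_M_coef_decay m phi hm hphi.
  have A0 : 0 < A by exact: lt_le_trans A1.
  exists D, A^-1; split=> //; first by rewrite invr_gt0.
  move=> xi; rewrite mulrC -ler_pdivrMr//.
  apply: lb_le_inf.
    by exists (m 0%N * 0`!%:R / (A^-1 ^+ 0 * (1 + enorm xi) ^+ 0)); exists 0%N.
  move=> _ [n ->].
  have e0 : 0 < 1 + enorm xi :> R by rewrite ltr_pwDl// enorm_ge0.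
  rewrite ler_pdivrMr// exprVn invfM invrK.
  have := decay n xi; rewrite mulrC -ler_pdivlMr ?exprn_gt0// => /le_trans; apply.
  by rewrite le_eqVlt; apply/orP; left; apply/eqP; ring.
Unshelve. all: by end_near.
Qed.
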